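(* Let $V$ be a finite set of $n\ge 3$ cities, let $G=(V,E)$ be the complete graph on $V$, and let $c:E\to\mathbb{R}_{\ge 0}$ be symmetric edge costs. Let $x$ be a fractional 2-matching (F2M) for $c$ whose support has no cut edge. Then there exists a graphical 2-matching (G2M) on $V$ whose cost is at most $\frac{4}{3}\sum_{e\in E}c(e)x(e)$.
   Context: A fractional 2-matching (F2M) is an optimal solution $x$ of the LP $\min \sum_{e\in E}c(e)x(e)$ subject to $\sum_{e\in\delta(i)}x(e)=2$ for all $i\in V$ and $0\le x(e)\le 1$ for all $e\in E$, where $\delta(i)$ is the set of edges incident to $i$; as in the paper, F2Ms are taken to have the standard (Balinski) structure of extreme-point solutions: every connected component of the support graph $\{e: x(e)>0\}$ is either a cycle on at least three vertices with $x(e)=1$ on all its edges (an integer component), or a fractional component consisting of odd cycles whose edges have $x(e)=\frac12$ (''cycle edges'') joined by paths whose edges have $x(e)=1$ (''path edges''). A cut edge is a path edge whose removal disconnects its fractional component of the support graph. A graphical 2-matching (G2M) is a multiset of edges of $G$ in which every vertex of $V$ has degree 2 or 4, every edge appears 0, 1 or 2 times, and every connected component has at least three vertices; its cost is the sum of $c(e)$ over the multiset (counted with multiplicity). *)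

(* Defs.v *)
From mathcomp Require Import all_boot all_order all_algebra.

Set Implicit Arguments.
Unset Strict Implicit.
Unset Printing Implicit Defensive.

Import Order.TTheory GRing.Theory Num.Theory.
Local Open Scope ring_scope.

Section Graphs.
Variable V : finType.

(* Edges of the complete graph are unordered pairs, so a cost function on them *)
(* is symmetric by construction. Functions on edges are total on {set V}; only *)
(* their values on [edges] ever matter. *)
Definition edges : {set {set V}} := [set e : {set V} | #|e| == 2%N].

Definition delta (i : V) : {set {set V}} := [set e in edges | i \in e].

Definition adj (F : {set {set V}}) : rel V := [rel u v | [set u; v] \in F].

Definition component (F : {set {set V}}) (v : V) : {set V} :=
  [set u | connect (adj F) v u].

Definition components (F : {set {set V}}) : {set {set V}} :=
  [set component F v | v : V].

Definition edges_in (F : {set {set V}}) (C : {set V}) : {set {set V}} :=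
  [set e in F | e \subset C].

(* Consecutive pairs of a vertex sequence, without (resp. with) the closing    *)
(* pair joining the last vertex to the first one. *)
Definition path_edges (p : seq V) : {set {set V}} :=
  [set:: [seq [set q.1; q.2] | q <- zip p (behead p)]].

Definition cycle_edges (p : seq V) : {set {set V}} :=
  [set:: [seq [set q.1; q.2] | q <- zip p (rot 1 p)]].

Definition is_cycle (p : seq V) : bool := uniq p && (2 < size p)%N.

(* p is a simple path with at least one edge, whose two (distinct) ends lie in *)
(* W and whose inner vertices avoid W. *)
Definition joining_path (W p : seq V) : Prop :=
  exists a s b,
    [/\ p = a :: rcons s b, uniq p, a \in W, b \in W
      & {in s, forall v, v \notin W}].

End Graphs.

Arguments edges V : clear implicits.

Section FractionalTwoMatchings.
Variables (R : realFieldType) (V : finType).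
Implicit Types (c x y : {set V} -> R) (C e : {set V}).

Definition cost c x : R := \sum_(e in edges V) c e * x e.

Definition lp_feasible x : Prop :=
  (forall i : V, \sum_(e in delta i) x e = 2) /\
  {in edges V, forall e, 0 <= x e <= 1}.

Definition lp_optimal c x : Prop :=
  lp_feasible x /\ forall y, lp_feasible y -> cost c x <= cost c y.

Definition supp x : {set {set V}} := [set e in edges V | 0 < x e].

Definition integer_component x C : Prop :=
  exists p : seq V,
    [/\ is_cycle p, C =i p, edges_in (supp x) C = cycle_edges p
      & {in cycle_edges p, forall e, x e = 1}].

(* The odd cycles [cs] are pairwise vertex-disjoint, as at extreme points.     *)
(* Disjointness of the paths [ps] costs nothing: under the degree constraints  *)
(* a cycle vertex meets exactly one edge of value 1, any other vertex two. *)
Definition fractional_component x C : Prop :=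
  exists cs ps : seq (seq V),
    [/\ {in cs, forall p, is_cycle p && odd (size p)} /\ uniq (flatten cs),
        {in ps, forall p, joining_path (flatten cs) p} /\ uniq (flatten ps),
        C =i flatten cs ++ flatten ps,
        edges_in (supp x) C =
          (\bigcup_(p <- cs) cycle_edges p) :|: (\bigcup_(p <- ps) path_edges p)
      & {in cs, forall p, {in cycle_edges p, forall e, x e = 1 / 2}} /\
        {in ps, forall p, {in path_edges p, forall e, x e = 1}}].

Definition balinski_structure x : Prop :=
  {in components (supp x), forall C,
    integer_component x C \/ fractional_component x C}.

Definition is_F2M c x : Prop := lp_optimal c x /\ balinski_structure x.

(* In a fractional component, the path edges are those of value 1. *)
Definition path_edge x C e : Prop :=
  [/\ C \in components (supp x), fractional_component x C,
      e \in edges_in (supp x) C & x e = 1].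

Definition cut_edge x e : Prop :=
  exists2 C, path_edge x C e &
    exists u v, [/\ u \in C, v \in C & ~~ connect (adj (supp x :\ e)) u v].

End FractionalTwoMatchings.

Section GraphicalTwoMatchings.
Variable V : finType.

(* A multiset of edges is given by its multiplicity function. *)
Definition multiset_support (m : {set V} -> nat) : {set {set V}} :=
  [set e in edges V | (0 < m e)%N].

Definition is_G2M (m : {set V} -> nat) : Prop :=
  [/\ forall i : V, (\sum_(e in delta i) m e)%N \in [:: 2; 4]%N,
      {in edges V, forall e, (m e <= 2)%N}
    & {in components (multiset_support m), forall C : {set V}, (3 <= #|C|)%N}].

End GraphicalTwoMatchings.

(* Main.v *)
Require Import Defs.
From mathcomp Require Import all_boot all_order all_algebra.
From mathcomp Require Import ring lra zify.

Set Implicit Arguments.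
Unset Strict Implicit.
Unset Printing Implicit Defensive.

Import Order.TTheory GRing.Theory Num.Theory.
Local Open Scope ring_scope.

(** Shrink every path of a fractional component to a single edge. The cycle
vertices then span a cubic multigraph, in which the half edges meeting any cut
are even in number; hence an odd cut contains one path or at least three edges,
and without cut edges it contains at least three. Edmonds' theorem therefore
writes the constant weight 1/3 as a convex combination of perfect matchings.
Given a perfect matching, drop its half edges, double its paths, and keep all
other support edges once: this is a G2M, and on average an edge of value 1/2
costs 2/3 and an edge of value 1 at most 4/3.

Edmonds' theorem is proved by induction on the number of vertices and on the
support. A tight nontrivial odd cut splits the problem into its two contractions,
whose matchings are glued along the crossing edge. Otherwise, a vertex of degree
one can be removed with its neighbour; a vertex of degree two forms with its two
neighbours a tight cut, or has two parallel edges that can be traded against each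
other; and if all degrees are at least three there are more edges than vertices,
so that the point can be moved in both directions along a kernel vector until an
edge vanishes or a cut becomes tight. *)

(** * Cuts of a multigraph given by its two end maps *)

Section Cuts.
Variables E V : finType.
Implicit Types (s t : E -> V) (U : {set V}) (e : E).

Definition cut s t U : {set E} := [set e | (s e \in U) != (t e \in U)].

Lemma cutC s t U : cut s t (~: U) = cut s t U.
Proof. by apply/setP=> e; rewrite !inE; case: (_ \in U); case: (_ \in U). Qed.

Lemma cut_preim s t (f : V -> V) U :
  cut (f \o s) (f \o t) U = cut s t (f @^-1: U).
Proof. by apply/setP=> e; rewrite !inE. Qed.

(** Double counting: an edge with distinct ends lies in the cut of [[set v]] exactly when [v] is one
    of them. A loop lies in no such cut, so loops must carry the value 0. *)
Lemma sum_cut1 (M : nmodType) s t U (z : E -> M) :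
    (forall e, z e != 0 -> s e != t e) ->
  \sum_(v in U) \sum_(e in cut s t [set v]) z e =
  \sum_e z e *+ ((s e \in U) + (t e \in U)).
Proof.
move=> zP; rewrite (exchange_big_dep xpredT) //=; apply: eq_bigr => e _.
have [->|/zP st] := eqVneq (z e) 0; first by rewrite big1 ?mul0rn.
rewrite sumr_const -sum1_card big_mkcondr; congr (_ *+ _).
transitivity (\sum_(v in U) ((s e == v) + (t e == v)))%N.
  apply: eq_bigr => v _; rewrite !inE.
  case: (eqVneq (s e) v) st => [->|_] st; last by case: (t e == v).
  by rewrite [t e == v]eq_sym (negbTE st).
have in1 a : (\sum_(v in U) (a == v) = (a \in U))%N.
  have -> : (\sum_(v in U) (a == v) = \sum_(v | pred1 a v) (v \in U))%N.
    rewrite -[LHS]big_mkcondr -[RHS]big_mkcondr.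
    by apply: eq_bigl => v /=; rewrite andbC eq_sym.
  by rewrite big_pred1_eq.
by rewrite big_split /= !in1.
Qed.

End Cuts.

(** * Fractional and integral perfect matchings *)

Section PerfectMatchingPolytope.
Variables (R : realFieldType) (E V : finType).
Implicit Types (s t : E -> V) (S U : {set V}) (x z : E -> R) (e : E).

Definition weight s t x U : R := \sum_(e in cut s t U) x e.

(** Edmonds' description of the perfect matching polytope. The vertex set [S] varies inside the
    fixed type [V], so that contracting or deleting vertices changes neither [V] nor [E]. *)
Definition fractional_pm s t S x : Prop :=
  [/\ forall e, 0 <= x e,
      forall e, x e != 0 -> [/\ s e \in S, t e \in S & s e != t e],
      forall v, v \in S -> weight s t x [set v] = 1
    & forall U, odd #|U :&: S| -> 1 <= weight s t x U].

(** Only members of nonzero weight have to be perfect matchings: gluing indexes the family by all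
    pairs of half matchings, and the incompatible pairs get weight 0. *)
Definition convex_of_pms s t S x : Prop :=
  exists (I : finType) (l : I -> R) (N : I -> {set E}),
    [/\ forall i, 0 <= l i, \sum_i l i = 1,
        forall e, \sum_(i | e \in N i) l i = x e
      & forall i, l i != 0 -> {in S, forall v, #|N i :&: cut s t [set v]| = 1%N}].

(* What remains of a convex combination of perfect matchings when only the
   edges that meet U are kept, all matchings crossing the cut of U once. *)
Definition convex_of_half_pms s t S U x : Prop :=
  exists (I : finType) (l : I -> R) (N : I -> {set E}),
    [/\ forall i, 0 <= l i, \sum_i l i = 1,
        forall e, (s e \in U) || (t e \in U) -> \sum_(i | e \in N i) l i = x e
      & forall i, l i != 0 ->
          [/\ {in N i, forall e, (s e \in U) || (t e \in U)},
              #|N i :&: cut s t U| = 1%N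
            & forall v, v \in S -> v \in U -> #|N i :&: cut s t [set v]| = 1%N]].

(** * Gluing matchings across a tight cut *)

Lemma le_marginal (I : finType) (l : I -> R) (P : pred I) i :
  (forall j, 0 <= l j) -> P i -> l i <= \sum_(j | P j) l j.
Proof. by move=> l0 Pi; rewrite (bigD1 i) //= lerDl sumr_ge0. Qed.

Lemma marginal_neq0 (I : finType) (l : I -> R) (P : pred I) i :
  (forall j, 0 <= l j) -> l i != 0 -> P i -> \sum_(j | P j) l j != 0.
Proof.
move=> l0 li Pi; have : 0 < l i by rewrite lt_def li l0.
by move=> li0; rewrite gt_eqF // (lt_le_trans li0) // le_marginal.
Qed.

(* The weight given to a pair of half matchings sharing the crossing edge e is
   the product of their weights, conditioned on e. *)
Definition glue_weight (I J : finType) (l : I -> R) (k : J -> R)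
    (N : I -> {set E}) (M : J -> {set E}) (D : {set E}) x (i : I) (j : J) : R :=
  \sum_(e in D | (e \in N i) && (e \in M j)) l i * k j / x e.

Lemma glue_weightC (I J : finType) (l : I -> R) (k : J -> R)
    (N : I -> {set E}) (M : J -> {set E}) D x i j :
  glue_weight l k N M D x i j = glue_weight k l M N D x j i.
Proof.
by apply: eq_big => [e|e _]; rewrite ?[(e \in N _) && _]andbC // [l i * _]mulrC.
Qed.

(** If [l i] is nonzero, [N i] meets [D] in a single edge [a]; the [M j] containing [a] have total
    weight [x a], which cancels the denominator. *)
Lemma glue_weight_marginal (I J : finType) (l : I -> R) (k : J -> R)
    (N : I -> {set E}) (M : J -> {set E}) (D : {set E}) x (P : pred I) :
    (forall i, 0 <= l i) ->
    (forall e, e \in D -> \sum_(i | e \in N i) l i = x e) ->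
    (forall e, e \in D -> \sum_(j | e \in M j) k j = x e) ->
    (forall i, l i != 0 -> #|N i :&: D| = 1%N) ->
  \sum_(i | P i) \sum_j glue_weight l k N M D x i j = \sum_(i | P i) l i.
Proof.
move=> l0 lE kE N1; apply: eq_bigr => i _.
rewrite /glue_weight.
rewrite (exchange_big_dep (fun e => (e \in D) && (e \in N i))) /=; last first.
  by move=> j e _ /and3P[-> ->].
have [li0|li0] := eqVneq (l i) 0.
  by rewrite big1 // => e _; rewrite big1 // => j _; rewrite li0 !mul0r.
have /eqP/cards1P[a Na] := N1 _ li0.
rewrite (eq_bigl (pred1 a)); last first.
  by move=> e; have /setP/(_ e) := Na; rewrite !inE andbC.
have /andP[aN aD] : (a \in N i) && (a \in D).
  by have /setP/(_ a) := Na; rewrite !inE eqxx.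
rewrite big_pred1_eq aD aN /= -mulr_suml -mulr_sumr kE // mulfK //.
by rewrite -lE // (marginal_neq0 (P := fun i => a \in N i) l0 li0 aN).
Qed.

Lemma meets_setC s t U e :
  (s e \in ~: U) || (t e \in ~: U) = ~~ ((s e \in U) && (t e \in U)).
Proof. by rewrite !inE negb_and. Qed.

(** The crossing edge of [B] already belongs to [A], and all other edges of [B] have both ends
    outside [U], so [B] adds nothing at a vertex of [U]. *)
Lemma half_sub_cut s t U (A B : {set E}) a v :
    B :&: cut s t U = [set a] -> a \in A ->
    {in B, forall e, (s e \in ~: U) || (t e \in ~: U)} -> v \in U ->
  (A :|: B) :&: cut s t [set v] = A :&: cut s t [set v].
Proof.
move=> Ba aA Bm vU; apply/setP=> e; rewrite !inE.
case eA : (e \in A) => //=; case eB : (e \in B) => //=.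
have /setP/(_ e) := Ba; rewrite !inE eB /=.
have -> : (e == a) = false by apply: contraFF eA => /eqP->.
have := Bm _ eB; rewrite !inE => eU /negbFE/eqP st.
have sU : s e \notin U by rewrite st orbb in eU *.
have tU : t e \notin U by rewrite -st.
have neqv w : w \notin U -> (w == v) = false by apply: contraNF => /eqP->.
by rewrite !neqv.
Qed.

(** Given the crossing edge, the two sides are drawn independently. A pair of nonzero weight shares
    its only crossing edge, so its union is a perfect matching, and each side keeps its
    marginals. *)
Lemma convex_of_pms_glue s t S U x :
    convex_of_half_pms s t S U x -> convex_of_half_pms s t S (~: U) x ->
  convex_of_pms s t S x.
Proof.
move=> [I [l [N [l0 l1 lE lN]]]] [J [k [M [k0 k1 kE kM]]]].
set D := cut s t U.
have DU e : e \in D -> (s e \in U) || (t e \in U).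
  by rewrite inE; case: (s e \in U); case: (t e \in U).
have DC e : e \in D -> (s e \in ~: U) || (t e \in ~: U).
  by rewrite !inE; case: (s e \in U); case: (t e \in U).
have lD e : e \in D -> \sum_(i | e \in N i) l i = x e by move/DU/lE.
have kD e : e \in D -> \sum_(j | e \in M j) k j = x e by move/DC/kE.
have ND i : l i != 0 -> #|N i :&: D| = 1%N by case/lN.
have MD j : k j != 0 -> #|M j :&: D| = 1%N by case/kM; rewrite cutC.
pose w i j := glue_weight l k N M D x i j.
have wE i j : w i j = glue_weight k l M N D x j i by exact: glue_weightC.
have sumI P : \sum_(i | P i) \sum_j w i j = \sum_(i | P i) l i.
  exact: glue_weight_marginal.
have sumJ P : \sum_(j | P j) \sum_i w i j = \sum_(j | P j) k j.
  rewrite -(@glue_weight_marginal _ _ k l M N D x P) //.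
  by apply: eq_bigr => j _; apply: eq_bigr => i _; rewrite wE.
have w_neq0 i j : w i j != 0 -> [/\ l i != 0, k j != 0 &
    exists a, [/\ N i :&: D = [set a], M j :&: D = [set a], a \in N i & a \in M j]].
  move=> wij; have [li|li] := eqVneq (l i) 0.
    by rewrite /w /glue_weight big1 ?eqxx // in wij => e _; rewrite li !mul0r.
  have [kj|kj] := eqVneq (k j) 0.
    by rewrite /w /glue_weight big1 ?eqxx // in wij => e _; rewrite kj mulr0 mul0r.
  split=> //; case: (pickP (fun e => [&& e \in D, e \in N i & e \in M j])) => [a|no].
    case/and3P=> aD aN aM; exists a.
    have /eqP/cards1P[b Nb] := ND _ li; have /eqP/cards1P[b' Mb] := MD _ kj.
    have : a \in N i :&: D by rewrite inE aN. have : a \in M j :&: D by rewrite inE aM.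
    by rewrite Nb Mb !inE => /eqP <- /eqP <-.
  by rewrite /w /glue_weight big_pred0 ?eqxx // in wij.
have w_ge0 i j : 0 <= w i j.
  apply: sumr_ge0 => e /andP[eD _].
  by rewrite divr_ge0 ?mulr_ge0 // -lD // sumr_ge0.
clearbody w => {wE}.
have zero (P Q : pred (I * J)) :
    (forall p, w p.1 p.2 != 0 -> P p = Q p) ->
  \sum_(p | P p) w p.1 p.2 = \sum_(p | Q p) w p.1 p.2.
  move=> PQ; rewrite big_mkcond [RHS]big_mkcond; apply: eq_bigr => p _.
  by have [->|/PQ->//] := eqVneq (w p.1 p.2) 0; rewrite !if_same.
exists (I * J)%type, (fun p => w p.1 p.2), (fun p => N p.1 :|: M p.2); split.
- by move=> p; exact: w_ge0.
- by rewrite -(pair_bigA _ w) /= sumI.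
- move=> e; case eU : ((s e \in U) || (t e \in U)).
    rewrite -lE // -(sumI (fun i => e \in N i)) pair_big_dep /=.
    (* An edge meeting [U] can lie in [M j] only as the crossing edge, and that edge lies in [N i]
       as well; so the marginal is that of the first side. *)
    rewrite (zero _ (fun p => (e \in N p.1) && true)) // => -[i j].
    case/w_neq0=> li kj [a [Na Ma aN aM]] /=; rewrite inE andbT; apply: orb_idr => eM.
    have [Mm _ _] := kM _ kj; have := Mm _ eM; rewrite meets_setC => eC.
    have eD : e \in D.
      by rewrite inE; move: eU eC; case: (s e \in U); case: (t e \in U).
    have : e \in M j :&: D by rewrite inE eM.
    by rewrite Ma inE => /eqP->.
  have eC : (s e \in ~: U) || (t e \in ~: U).
    by rewrite meets_setC; move: eU; case: (s e \in U).
  rewrite -kE // -(sumJ (fun i => e \in M i)) (exchange_big_dep xpredT) //= pair_big_dep /=.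
  rewrite (zero _ (fun p => (e \in M p.2) && true)) // => -[i j].
  case/w_neq0=> li kj _ /=; rewrite inE andbT; apply: orb_idl => eN.
  by have [Nm _ _] := lN _ li; have := Nm _ eN; rewrite eU.
move=> [i j] /w_neq0[li kj [a [Na Ma aN aM]]] v vS /=.
have [Nm _ Nv] := lN _ li; have [Mm _ Mv] := kM _ kj.
case vU : (v \in U); first by rewrite (half_sub_cut Ma) ?Nv.
rewrite setUC (@half_sub_cut s t (~: U) (M j) (N i) a) ?Mv // ?inE ?vU //.
  by rewrite cutC.
by move=> e /Nm; rewrite setCK.
Qed.

(** * Contraction, convex combination and removal of an edge *)

Lemma weight_setC s t x U : weight s t x (~: U) = weight s t x U.
Proof. by rewrite /weight cutC. Qed.

Lemma eq_cut_weight s t x U W :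
    (forall e, x e != 0 -> (e \in cut s t U) = (e \in cut s t W)) ->
  weight s t x U = weight s t x W.
Proof.
move=> UW; rewrite /weight big_mkcond [RHS]big_mkcond; apply: eq_bigr => e _.
by have [->|/UW->//] := eqVneq (x e) 0; rewrite !if_same.
Qed.

Lemma weight_setI s t x S U : (forall e, x e != 0 -> s e \in S /\ t e \in S) ->
  weight s t x (U :&: S) = weight s t x U.
Proof.
by move=> xS; apply: eq_cut_weight => e /xS[sS tS]; rewrite !inE sS tS !andbT.
Qed.

(** The whole vertex set has an empty cut, so an odd [S] would require [1 <= 0]. *)
Lemma fractional_pm_even s t S x : fractional_pm s t S x -> ~~ odd #|S|.
Proof.
move=> [_ xS _ xU]; apply/negP=> oS; have := xU setT; rewrite setTI => /(_ oS).
by rewrite /weight big1 ?ler10 // => e; rewrite !inE.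
Qed.

(* Contracting the complement of U to one of its vertices. *)
Lemma half_pms_of_contraction s t S U x (c : V) (f := fun v => if v \in U then v else c)
    (x' := fun e => if (s e \in U) || (t e \in U) then x e else 0) :
    fractional_pm s t S x -> weight s t x U = 1 -> odd #|U :&: S| ->
    c \in S -> c \notin U ->
    (fractional_pm (f \o s) (f \o t) (c |: (S :&: U)) x' ->
     convex_of_pms (f \o s) (f \o t) (c |: (S :&: U)) x') ->
  convex_of_half_pms s t S U x.
Proof.
move=> xP xU1 oU cS cU IH; have [x0 xS xv xU] := xP.
have eS := fractional_pm_even xP.
have oUC : odd #|S :\: U|.
  by move: eS; rewrite -(cardsID U S) oddD setIC oU; case: odd.
have preC : f @^-1: [set c] = ~: U.
  apply/setP=> v; rewrite !inE /f; case: ifP => [vU|]; last by rewrite eqxx.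
  by apply: contraNF cU => /eqP<-.
have pre1 v : v \in U -> f @^-1: [set v] = [set v].
  move=> vU; apply/setP=> w; rewrite !inE /f; case: ifP => // wU.
  have -> : (c == v) = false by apply: contraNF cU => /eqP->.
  by apply/esym; apply: contraFF wU => /eqP->.
have cutx e W : e \in cut s t (f @^-1: W) -> (s e \in U) || (t e \in U).
  by rewrite !inE /f; case: (s e \in U); case: (t e \in U); rewrite ?eqxx.
have wx' W : weight (f \o s) (f \o t) x' W = weight s t x (f @^-1: W).
  by rewrite /weight cut_preim; apply: eq_bigr => e /cutx; rewrite /x' => ->.
have [|I [l [N [l0 l1 lE lN]]]] := IH.
  split=> [e|e|v|W].
  - by rewrite /x'; case: ifP.
  - rewrite /x' /=; case: ifP; rewrite ?eqxx // => eU /xS[sS tS st].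
    rewrite /f; have fS v : v \in S -> (if v \in U then v else c) \in c |: (S :&: U).
      by move=> vS; case: ifP => vU; rewrite !inE ?eqxx // vS vU orbT.
    split; [exact: fS | exact: fS |].
    case: ifP => sU; case: ifP => tU //; last by rewrite sU tU in eU.
      by apply: contraNneq cU => <-.
    by apply: contraNneq cU => ->.
  - rewrite wx' !inE => /orP[/eqP->|/andP[vS vU]]; first by rewrite preC weight_setC.
    by rewrite pre1 ?xv.
  - rewrite wx' => oW; apply: xU; move: oW.
    (* The set [S :\: U] is odd, hence has the parity of the single vertex [c] to which it is
       contracted: odd sets pull back to odd sets. *)
    have -> : f @^-1: W :&: S = (W :&: (S :&: U)) :|: (if c \in W then S :\: U else set0).
      apply/setP=> v; rewrite !inE /f; case: ifP => vU.
        by case: ifP => _; rewrite !inE ?vU /= ?andbT ?orbF.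
      by case: ifP => _; rewrite !inE ?vU ?andbF //= andbT.
    set A := S :&: U; have cA : c \notin A by rewrite inE (negbTE cU) andbF.
    case: ifP => cW; last first.
      rewrite setU0 (_ : W :&: (c |: A) = W :&: A) //; apply/setP=> v.
      by rewrite [LHS]in_setI [RHS]in_setI in_setU1; case: eqVneq => [->|_]; rewrite ?cW.
    have -> : W :&: (c |: A) = c |: (W :&: A).
      by apply/setP=> v; rewrite [LHS]in_setI !in_setU1 in_setI; case: eqVneq => [->|_]; rewrite ?cW.
    rewrite cardsU1 in_setI (negbTE cA) andbF cardsU.
    rewrite (_ : W :&: A :&: (S :\: U) = set0) ?cards0 ?subn0 ?oddD ?oUC ?addbT //.
    by apply/setP=> v; rewrite !inE; case: (v \in U); rewrite ?andbF.
exists I, l, N; split=> // [e eU|i li].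
  by rewrite lE /x' eU.
split=> [e eN|| v vS vU].
- have := marginal_neq0 (P := fun i => e \in N i) l0 li eN.
  by rewrite lE /x'; case: ifP => //; rewrite eqxx.
(* The preimage of [[set c]] is the complement of [U], so covering [c] once means crossing the cut
   of [U] once. *)
- by have := lN _ li c; rewrite cut_preim preC cutC; apply; rewrite setU11.
by have := lN _ li v; rewrite cut_preim pre1 //; apply; rewrite !inE vS vU orbT.
Qed.

Lemma convex_of_pms_combine s t S x x1 x2 (a b : R) :
    convex_of_pms s t S x1 -> convex_of_pms s t S x2 ->
    0 <= a -> 0 <= b -> a + b = 1 -> (forall e, x e = a * x1 e + b * x2 e) ->
  convex_of_pms s t S x.
Proof.
move=> [I [l [N [l0 l1 lE lN]]]] [J [k [M [k0 k1 kE kM]]]] a0 b0 ab xE.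
exists (I + J)%type, (fun p => match p with inl i => a * l i | inr j => b * k j end),
  (fun p => match p with inl i => N i | inr j => M j end); split.
- by case=> i; rewrite mulr_ge0.
- by rewrite big_sumType /= -!mulr_sumr l1 k1 !mulr1.
- by move=> e; rewrite big_sumType /= -!mulr_sumr lE kE xE.
by case=> i; rewrite mulf_eq0 negb_or => /andP[_]; [apply: lN | apply: kM].
Qed.

Lemma convex_of_pms_set0 s t x : fractional_pm s t set0 x -> convex_of_pms s t set0 x.
Proof.
move=> [_ xS _ _]; exists unit, (fun=> 1), (fun=> set0); split=> //.
- by rewrite big_const card_unit /= addr0.
- move=> e; rewrite big_pred0; last by move=> i; rewrite inE.
  by apply/esym/eqP; apply: contraT => /xS[]; rewrite inE.
by move=> i _ v; rewrite inE.
Qed.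

(** * Moving along a direction until a constraint becomes tight *)

(** The ratio test of the simplex method: [r] is the least [a i / - b i] over the decreasing
    coordinates. *)
Lemma first_vanishing (I : finType) (a b : I -> R) :
    (forall i, 0 <= a i) -> (forall i, b i < 0 -> 0 < a i) -> (exists i, b i < 0) ->
  exists2 r, 0 < r &
    (forall i, 0 <= a i + r * b i) /\ exists2 i, b i < 0 & a i + r * b i = 0.
Proof.
move=> a0 ab [i0 bi0].
case: (@Order.TotalTheory.arg_minP _ _ _ i0 (fun i => b i < 0) (fun i => a i / - b i)) => // i bi imin.
exists (a i / - b i); first by rewrite divr_gt0 ?oppr_gt0 ?ab.
split=> [j|]; last by exists i => //; field; rewrite lt_eqF.
have [bj|bj] := ltP (b j) 0; last first.
  by rewrite addr_ge0 // mulr_ge0 // divr_ge0 // oppr_ge0 ltW.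
have := imin j bj; rewrite ler_pdivlMr ?oppr_gt0 // mulrN.
by rewrite lerNl => h; lra.
Qed.

Lemma big_cut_pair s t x U e h : (forall e, 0 <= x e) ->
  e != h -> e \in cut s t U -> h \in cut s t U -> x e + x h <= weight s t x U.
Proof.
move=> x0 eh eU hU; rewrite /weight (bigD1 e) //= lerD2l (bigD1 h) /=.
  by rewrite lerDl sumr_ge0.
by rewrite hU eq_sym.
Qed.

(** An edge of weight 1 saturates both of its ends, so no other support edge meets them; [e] can
    then be added to every matching of the remaining vertices. *)
Lemma convex_of_pms_remove s t S x e (x' := fun h => if h == e then 0 else x h) :
    fractional_pm s t S x -> x e = 1 ->
    (fractional_pm s t (S :\: [set s e; t e]) x' ->
     convex_of_pms s t (S :\: [set s e; t e]) x') ->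
  convex_of_pms s t S x.
Proof.
move=> [x0 xS xv xU] xe1 IH; set T := [set s e; t e].
have [sS tS st] : [/\ s e \in S, t e \in S & s e != t e].
  by apply: xS; rewrite xe1 oner_eq0.
have eT v : v \in T -> e \in cut s t [set v].
  by rewrite !inE => /orP[]/eqP->; rewrite eqxx; [rewrite eq_sym in st|]; rewrite (negbTE st).
have TS v : v \in T -> v \in S by rewrite !inE => /orP[]/eqP->.
have hT h v : x h != 0 -> h != e -> v \in T -> h \notin cut s t [set v].
  move=> xh he vT; apply/negP=> hv.
  have := big_cut_pair x0 he hv (eT _ vT); rewrite xv ?TS // xe1.
  by have := x0 h; rewrite le_eqVlt eq_sym (negbTE xh) /=; lra.
have hT' h : x h != 0 -> h != e -> s h \notin T /\ t h \notin T.
  move=> xh he; have [_ _ sth] := xS _ xh.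
  split; apply/negP=> /(hT _ _ xh he); rewrite !inE eqxx; first by rewrite [t h == _]eq_sym (negbTE sth).
  by rewrite (negbTE sth).
have wx' U : weight s t x' U = weight s t x (U :\: T).
  rewrite /weight big_mkcond [RHS]big_mkcond; apply: eq_bigr => h _; rewrite /x'.
  have [->|he] := eqVneq h e; first by rewrite if_same !inE !eqxx orbT.
  have [->|xh] := eqVneq (x h) 0; first by rewrite !if_same.
  by have [sT tT] := hT' _ xh he; rewrite ![h \in _]in_set !in_setD sT tT.
have [|I [l [N [l0 l1 lE lN]]]] := IH.
  split=> [h|h|v|U].
  - by rewrite /x'; case: ifP.
  - rewrite /x'; have [_|he] := eqVneq h e; first by rewrite eqxx.
    move=> xh; have [sT tT] := hT' _ xh he; have [? ? ?] := xS _ xh.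
    by rewrite !in_setD sT tT.
  - rewrite inE => /andP[vT vS]; rewrite wx' -(xv v) //; congr weight.
    by apply/setP=> w; rewrite in_setD !in_set1; case: eqVneq => [->|]; rewrite ?vT ?andbF.
  - by rewrite wx' setIDA -setIDAC; apply: xU.
exists I, l, (fun i => e |: N i); have x'N h i : l i != 0 -> h \in N i -> x' h != 0.
  by move=> li hN; rewrite -lE (marginal_neq0 (P := fun i => h \in N i) l0 li hN).
split=> // [h|i li v vS].
  have [->|he] := eqVneq h e.
    by rewrite xe1 -l1; apply: eq_bigl => i; rewrite !inE eqxx.
  have -> : x h = x' h by rewrite /x' (negbTE he).
  by rewrite -lE; apply: eq_bigl => i; rewrite in_setU1 (negbTE he).
have [vT|vT] := boolP (v \in T).
  apply/eqP/cards1P; exists e; apply/setP=> h; rewrite in_setI in_setU1 in_set1.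
  have [->|he] := eqVneq h e; first by rewrite eT.
  apply/negP=> /andP[hN]; apply/negP.
  by apply: hT => //; have := x'N _ _ li hN; rewrite /x' (negbTE he).
rewrite -(lN i li v); last by rewrite in_setD vT.
apply: eq_card => h; rewrite !in_setI in_setU1.
have [->|he //] := eqVneq h e.
rewrite andTb; have -> : e \in cut s t [set v] = false; last by rewrite andbF.
apply: contraNF vT; rewrite in_set !in_set1 in_set2 ![v == _]eq_sym.
by case: (s e == v); case: (t e == v).
Qed.

Definition fsupp x : {set E} := [set e | x e != 0].

Lemma weightD s t x z (r : R) U :
  weight s t (fun e => x e + r * z e) U = weight s t x U + r * weight s t z U.
Proof. by rewrite /weight big_split /= mulr_sumr. Qed.

(** The motion stops when the value of an edge or the slack of an odd set first vanishes. The only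
    odd cuts tight at the start are those with a single vertex of [S] on one side, and there [z] has
    weight 0, so they stay tight. *)
Lemma perturb s t S x z :
    fractional_pm s t S x ->
    (forall U, odd #|U :&: S| -> (1 < #|U :&: S|)%N -> (1 < #|S :\: U|)%N ->
      weight s t x U != 1) ->
    (forall e, z e != 0 -> x e != 0) ->
    (forall v, v \in S -> weight s t z [set v] = 0) -> (exists e, z e != 0) ->
  exists (r : R) (y := fun e => x e + r * z e), [/\ 0 < r, fractional_pm s t S y &
    (#|fsupp y| < #|fsupp x|)%N \/
    exists U, [/\ odd #|U :&: S|, (1 < #|U :&: S|)%N, (1 < #|S :\: U|)%N
                & weight s t y U = 1]].
Proof.
move=> xP xnt zx zv [e0 ze0]; have [x0 xS xv xU] := xP.
have eS := fractional_pm_even xP.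
have z0 e : x e = 0 -> z e = 0.
  by move=> xe; apply/eqP; apply: contraTT (eqxx (x e)) => /zx; rewrite xe.
have xgt e : x e != 0 -> 0 < x e by rewrite lt_def x0 andbT.
have zS e : z e != 0 -> s e \in S /\ t e \in S by case/zx/xS.
have card1W W : odd #|W :&: S| -> (#|W :&: S| <= 1)%N -> weight s t z W = 0.
  rewrite leq_eqVlt ltnS leqn0 => oW /orP[/cards1P[v Wv]|/eqP W0]; last first.
    by rewrite W0 in oW.
  have /setIP[_ vS] : v \in W :&: S by rewrite Wv set11.
  by rewrite -(weight_setI _ zS) Wv zv.
have nt U : odd #|U :&: S| -> weight s t z U != 0 ->
    (1 < #|U :&: S|)%N /\ (1 < #|S :\: U|)%N.
  move=> oU wU; split; rewrite ltnNge; apply: contra wU => le1; first by rewrite card1W.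
  rewrite -weight_setC card1W // setIC -setDE //.
  by move: eS; rewrite -(cardsID U S) oddD setIC oU; case: odd.
(* The coordinates are the edge values and the slacks of the odd sets. Even sets get the constant 1
   with slope 0, so they never stop the motion. *)
pose a (i : E + {set V}) := match i with inl e => x e
  | inr U => if odd #|U :&: S| then weight s t x U - 1 else 1 end.
pose b (i : E + {set V}) := match i with inl e => z e
  | inr U => if odd #|U :&: S| then weight s t z U else 0 end.
have [|||r r0 [ab [i bi abi]]] := @first_vanishing _ a b.
- by case=> [e|U] //=; case: ifP => // /xU; rewrite subr_ge0.
- case=> [e|U] /=; first by move=> ze; apply/xgt/zx; rewrite lt_eqF.
  case: ifP => [oU wU|]; last by rewrite ltxx.
  have [||c1 c2] := nt U; rewrite ?lt_eqF //.
  by rewrite subr_gt0 lt_def xnt ?xU.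
(* Some coordinate decreases: if [z e0] is positive, the zero weight of [z] at the end [s e0] forces
   a negative value on some edge. *)
- have [ze|ze|ze] := ltgtP (z e0) 0; last by rewrite ze eqxx in ze0.
    by exists (inl e0).
  have [sS _ st] := xS _ (zx _ ze0).
  case: (pickP (fun e => z e < 0)) => [e ze'|no]; first by exists (inl e).
  have := zv _ sS; rewrite /weight (bigD1 e0) /=; last first.
    by rewrite !inE eqxx [t e0 == _]eq_sym (negbTE st).
  move/eqP; rewrite gt_eqF // ltr_wpDr // sumr_ge0 // => e _.
  by rewrite leNgt no.
exists r; split=> //.
  split=> [e|e|v vS|U oU].
  - exact: (ab (inl e)).
  - by move=> ye; apply: xS; apply: contraNneq ye => xe; rewrite xe z0 ?mulr0 ?addr0.
  - by rewrite weightD xv // zv // mulr0 addr0.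
  - by rewrite weightD; have := ab (inr U); rewrite /= oU; lra.
case: i bi abi => [e|U] /=.
  move=> ze ye; left; apply: proper_card; apply/properP; split.
    apply/subsetP=> h; rewrite !inE; apply: contraNneq => xh.
    by rewrite xh z0 ?mulr0 ?addr0.
  by exists e; rewrite !inE ?ye ?eqxx // zx // lt_eqF.
case: ifP; rewrite ?ltxx // => oU wU yU; right; exists U.
have [||c1 c2] := nt U; rewrite ?lt_eqF //; split=> //.
by rewrite weightD; lra.
Qed.

(** There are more unknowns, indexed by [T], than equations, indexed by [S]. The unknowns index the
    rows of [M], so a solution is a row vector of its left kernel. *)
Lemma exists_kernel (T : {set E}) S (A : V -> E -> R) : (#|S| < #|T|)%N ->
  exists z : E -> R, [/\ forall e, e \notin T -> z e = 0, exists e, z e != 0 &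
    forall v, v \in S -> \sum_e A v e * z e = 0].
Proof.
move=> ST.
pose M := \matrix_(i < #|T|, j < #|S|) A (enum_val j) (enum_val i).
have : kermx M != 0.
  rewrite -mxrank_eq0 mxrank_ker subn_eq0 -ltnNge.
  by rewrite (leq_ltn_trans (rank_leq_col M)).
case/rowV0Pn=> r /sub_kermxP rM r0.
(* Extension by zero: the sum has one term if [e] is in [T] and none otherwise. *)
pose z e := \sum_(i < #|T| | enum_val i == e) r 0 i.
have zE i : z (enum_val i) = r 0 i.
  rewrite /z (eq_bigl (pred1 i)) ?big_pred1_eq // => j /=.
  by rewrite (inj_eq enum_val_inj).
have z_out e : e \notin T -> z e = 0.
  by move=> eT; rewrite /z big_pred0 // => i; apply: contraNF eT => /eqP<-; exact: enum_valP.
exists z; split=> [//||v vS].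
- have /rV0Pn[i ri] := r0; by exists (enum_val i); rewrite zE.
have /rowP/(_ (enum_rank_in vS v)) := rM; rewrite !mxE => rv; rewrite -[RHS]rv.
rewrite (bigID (mem T)) /= [X in _ + X]big1 ?addr0; last first.
  by move=> e eT; rewrite z_out ?mulr0.
rewrite big_enum_val; apply: eq_bigr => i _.
by rewrite zE mxE enum_rankK_in // mulrC.
Qed.

Lemma sum_weight1 s t x U : (forall e, x e != 0 -> s e != t e) ->
  \sum_(v in U) weight s t x [set v] =
  weight s t x U + 2 * \sum_(e | (s e \in U) && (t e \in U)) x e.
Proof.
move=> xst; rewrite /weight sum_cut1 // mulr_sumr big_mkcond [RHS]addrC.
rewrite [X in X + _]big_mkcond [X in _ + X]big_mkcond -big_split; apply: eq_bigr => e _ /=.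
by rewrite inE; case: (s e \in U); case: (t e \in U); rewrite /= ?mulr2n ?mulr1n ?mulr0n; ring.
Qed.

Lemma joins_cut s t e u v : e \in cut s t [set u] -> e \in cut s t [set v] -> u != v ->
  (s e = u /\ t e = v) \/ (s e = v /\ t e = u).
Proof.
rewrite !inE; case: (eqVneq (s e) u) => [->|_]; last first.
  case: (eqVneq (t e) u) => // -> _; case: (eqVneq (s e) v) => [->|_]; first by right.
  by case: (eqVneq u v).
by case: (eqVneq u v) => // _ _ /=; case: (eqVneq (t e) v) => // -> _; left.
Qed.

Lemma card_set2I (A : {set E}) a b : a != b ->
  #|[set a; b] :&: A| = ((a \in A) + (b \in A))%N.
Proof.
move=> ab; rewrite -sum1_card (eq_bigl (fun e => (e \in [set a; b]) && (e \in A))); last first.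
  by move=> e; rewrite inE.
by rewrite big_mkcondr /= big_setU1 ?inE //= big_set1; case: (a \in A); case: (b \in A).
Qed.

(** * A vertex [v] of degree two with distinct neighbours [u] and [w] *)

Section DegreeTwo.
Variables (s t : E -> V) (S : {set V}) (x : E -> R) (e f : E) (u v w : V).
Let U := [set u; v; w].
Hypotheses (xP : fractional_pm s t S x)
  (uS : u \in S) (vS : v \in S) (wS : w \in S)
  (uv : u != v) (vw : v != w) (uw : u != w)
  (eu : e \in cut s t [set u]) (ev : e \in cut s t [set v])
  (fv : f \in cut s t [set v]) (fw : f \in cut s t [set w])
  (vef : forall h, h \in cut s t [set v] -> x h != 0 -> (h == e) || (h == f)).

Let x0 := let: And4 x0 _ _ _ := xP in x0.
Let xS := let: And4 _ xS _ _ := xP in xS.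
Let xv := let: And4 _ _ xv _ := xP in xv.
Let xU := let: And4 _ _ _ xU := xP in xU.

Let ecut W : (e \in cut s t W) = ((u \in W) != (v \in W)).
Proof. by rewrite inE; have [[-> ->]|[-> ->]] := joins_cut eu ev uv; rewrite // eq_sym. Qed.

Let fcut W : (f \in cut s t W) = ((v \in W) != (w \in W)).
Proof. by rewrite inE; have [[-> ->]|[-> ->]] := joins_cut fv fw vw; rewrite // eq_sym. Qed.

Let inU : (u \in U) * (v \in U) * (w \in U).
Proof. by rewrite /U !inE !eqxx !orbT. Qed.

Let ef : e != f.
Proof. by apply: contraTneq eu => ->; rewrite fcut !inE ![_ == u]eq_sym (negbTE uv) (negbTE uw). Qed.

Lemma degree_two_weight : x e + x f = 1.
Proof.
rewrite -(xv vS) /weight (bigD1 e) //= (bigD1 f) /=; last by rewrite fv eq_sym ef.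
rewrite big1 ?addr0 // => h /andP[/andP[hv he] hf]; apply/eqP; apply: contraT => xh.
by have := vef hv xh; rewrite (negbTE he) (negbTE hf).
Qed.

Let eU : (s e \in U) && (t e \in U).
Proof. by have [[-> ->]|[-> ->]] := joins_cut eu ev uv; rewrite !inU. Qed.

Let fU : (s f \in U) && (t f \in U).
Proof. by have [[-> ->]|[-> ->]] := joins_cut fv fw vw; rewrite !inU. Qed.

(** The three vertex equations sum to 3, which is the weight of the cut of [U] plus twice the weight
    inside. The former is at least 1 because [U] is odd, the latter at least [x e + x f = 1], so
    both bounds are attained. *)
Let weightU_inside : weight s t x U = 1 /\
  forall h, (s h \in U) && (t h \in U) -> h != e -> h != f -> x h = 0.
Proof.
have US : U :&: S = U.
  by apply/setIidPl/subsetP=> a; rewrite !inE => /orP[/orP[]|]/eqP->.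
have U3 : #|U| = 3%N.
  by rewrite /U setUC cardsU1 cards2 uv !inE ![w == _]eq_sym (negbTE uw) (negbTE vw).
have := xU (U := U); rewrite US U3 => /(_ isT) wU.
have : \sum_(a in U) weight s t x [set a] = 3.
  rewrite (eq_bigr (fun=> 1)); first by rewrite sumr_const U3.
  by move=> a; rewrite -US inE => /andP[_ /xv].
rewrite sum_weight1; last by move=> h /xS[].
rewrite (bigD1 e) //= (bigD1 f) /=; last by rewrite fU eq_sym ef.
set r := \sum_(_ | _) _; have r0 : 0 <= r by apply: sumr_ge0.
have := degree_two_weight => xef sum3; split; first by lra.
have /eqP : r = 0 by lra.
rewrite psumr_eq0 // => /allP hr h hU he hf.
by have := hr h; rewrite mem_index_enum hU he hf /= => /(_ isT)/eqP.
Qed.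

Lemma degree_two_tight : weight s t x U = 1.
Proof. by case: weightU_inside. Qed.

(** The support edges at [v] are [e] and [f], both inside [U]; so a crossing edge has its end in [U]
    at exactly one of [u] and [w]. *)
Let cutU_split g : g \in cut s t U -> x g != 0 ->
  g \notin cut s t [set v] /\ (g \in cut s t [set u]) = (g \notin cut s t [set w]).
Proof.
move=> gU xg; have gv : g \notin cut s t [set v].
  apply/negP=> /vef-/(_ xg)/orP[]/eqP gE; move: gU; rewrite gE.
    by rewrite ecut !inU.
  by rewrite fcut !inU.
split=> //; have key a b : a \in U -> b \notin U -> (a == v) != (b == v) = false ->
    ((a == u) != (b == u)) = ~~ ((a == w) != (b == w)).
  move=> aU; rewrite !inE !negb_or => /andP[/andP[/negbTE-> /negbTE->] /negbTE->].
  move: aU; rewrite !inE; case: (eqVneq a u) => [->|_]; first by rewrite (negbTE uw).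
  by case: (a == v) => //=; case: (a == w).
move: gU gv; rewrite ![g \in _]inE !in_set1 => gU /negbTE gv.
case sU: (s g \in U) gU => tU; first by apply: key => //; case: (t g \in U) tU.
rewrite ![(s g == _) == _]eq_sym; apply: key; rewrite ?sU //.
  by case: (t g \in U) tU.
by rewrite eq_sym.
Qed.

(** The inner edge that covers the two vertices of [U] missed by the crossing edge [g]. *)
Let partner g := if g \in cut s t [set u] then f else e.

Let part_weight a h : a \in S -> h \in cut s t [set a] -> ~~ (h \in cut s t U) ->
    (forall k, k \in cut s t [set a] -> x k != 0 -> k \notin cut s t U -> k = h) ->
  \sum_(g in cut s t U | g \in cut s t [set a]) x g = 1 - x h.
Proof.
move=> aS ha hU only; rewrite -(xv aS) /weight [in RHS](bigID (mem (cut s t U))) /=.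
rewrite [X in _ = _ + X - _](bigD1 h) ?ha //= [X in _ = _ + (_ + X) - _]big1; last first.
  move=> k /andP[/andP[ka kU] kh]; apply/eqP; apply: contraNT kh => xk.
  by rewrite (only k).
rewrite addr0 addrK; apply: eq_bigl => g; exact: andbC.
Qed.

(** The family is indexed by the crossing edges: [g], with weight [x g], is completed by its
    partner. Induction would not do here, since contracting the complement of [U] leaves four
    vertices, no fewer than [S] may have. *)
Lemma degree_two_half : convex_of_half_pms s t S U x.
Proof.
have [wU inside] := weightU_inside.
have eNU : e \notin cut s t U by rewrite ecut !inU.
have fNU : f \notin cut s t U by rewrite fcut !inU.
have uvF := negbTE uv; have vwF := negbTE vw; have uwF := negbTE uw.
have fu : f \notin cut s t [set u].
  by rewrite fcut !inE ![_ == u]eq_sym uvF uwF.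
have ew : e \notin cut s t [set w] by rewrite ecut !inE vwF uwF.
have inner a k : a \in U -> k \in cut s t [set a] -> x k != 0 -> k \notin cut s t U ->
    (k == e) || (k == f).
  move=> aU ka xk kU; apply: contraT; rewrite negb_or => /andP[ke kf].
  case/eqP: xk; apply: inside => //; move: ka kU; rewrite ![k \in _]inE negbK !in_set1.
  case: (eqVneq (s k) a) => [->|_]; first by rewrite aU => _ /eqP<-.
  by case: (eqVneq (t k) a) => // ->; rewrite aU => _ /eqP->.
pose l g := if g \in cut s t U then x g else 0.
have l_neq0 g : l g != 0 -> g \in cut s t U /\ x g != 0.
  by rewrite /l; case: ifP; rewrite ?eqxx.
have lsum P : \sum_(g | P g) l g = \sum_(g in cut s t U | P g) x g.
  by rewrite /l -big_mkcondr; apply: eq_bigl => g; rewrite andbC.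
exists E, l, (fun g => [set g; partner g]); split.
- by move=> g; rewrite /l; case: ifP.
- by rewrite lsum -wU; apply: eq_bigl => g; rewrite andbT.
- move=> h hU; rewrite lsum; have [hcU|hcU] := boolP (h \in cut s t U).
    rewrite (eq_bigl (pred1 h)) ?big_pred1_eq // => g.
    rewrite in_set2 /partner /=; have he : h != e by apply: contraTneq hcU => ->.
    have hf : h != f by apply: contraTneq hcU => ->.
    have -> : (h == (if g \in cut s t [set u] then f else e)) = false.
      by case: ifP => _; apply: negbTE.
    by rewrite orbF [h == g]eq_sym; case: (eqVneq g h) => [->|_]; rewrite ?andbF ?hcU.
  have hin : (s h \in U) && (t h \in U).
    by move: hcU hU; rewrite inE; case: (s h \in U); case: (t h \in U).
  rewrite (eq_bigl (fun g => (g \in cut s t U) && (h == partner g))); last first.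
    move=> g; rewrite in_set2; case: (eqVneq h g) hcU => [->|_] //=.
    by move/negbTE->.
  (* The edge [e] is the partner of the crossing edges at [w], whose total weight is [1 - x f], that
     is [x e]. The case of [f] is symmetric, with [u] in place of [w]. *)
  have [he|he] := eqVneq h e.
    rewrite he; have -> : x e = 1 - x f by rewrite -degree_two_weight; ring.
    rewrite -(part_weight wS fw fNU); last first.
      move=> k kw xk kU; have [ke|//] := orP (inner _ _ inU.2 kw xk kU).
        by rewrite (eqP ke) (negbTE ew) in kw.
      by move/eqP.
    rewrite big_mkcond [RHS]big_mkcond; apply: eq_bigr => g _.
    have [gU|//] := boolP (g \in cut s t U); have [->|xg] := eqVneq (x g) 0.
      by rewrite !if_same.
    have [_ guw] := cutU_split gU xg; rewrite /partner guw /=.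
    by case: (g \in cut s t [set w]); rewrite ?eqxx // (negbTE ef).
  have [hf|hf] := eqVneq h f.
    rewrite hf; have -> : x f = 1 - x e by rewrite -degree_two_weight; ring.
    rewrite -(part_weight uS eu eNU); last first.
      move=> k ku xk kU; have [/eqP //|kf] := orP (inner _ _ inU.1.1 ku xk kU).
      by rewrite (eqP kf) (negbTE fu) in ku.
    apply: eq_bigl => g; congr (_ && _); rewrite /partner.
    by case: ifP; rewrite ?eqxx // eq_sym (negbTE ef).
  rewrite inside // big_pred0 // => g; rewrite /partner.
  by case: ifP => _; rewrite ?(negbTE he) ?(negbTE hf) andbF.
move=> g /l_neq0[gU xg]; have [gv guw] := cutU_split gU xg.
have ge : g != e by apply: contraTneq gU => ->.
have gf : g != f by apply: contraTneq gU => ->.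
have gp : g != partner g by rewrite /partner; case: ifP.
have pcut W : (partner g \in cut s t W) =
    if g \in cut s t [set u] then f \in cut s t W else e \in cut s t W.
  by rewrite /partner; case: ifP.
split=> [h||a aS].
- rewrite in_set2 => /orP[/eqP->|/eqP->].
    by move: gU; rewrite inE; case: (s g \in U); case: (t g \in U).
  by rewrite /partner; case: ifP => _; [case/andP: fU | case/andP: eU] => ->.
- by rewrite card_set2I // pcut gU (negbTE eNU) (negbTE fNU) if_same.
rewrite !inE => /orP[/orP[]|]/eqP->; rewrite card_set2I // pcut.
- by rewrite eu (negbTE fu); case: ifP.
- by rewrite ev fv if_same (negbTE gv).
- by rewrite fw (negbTE ew) guw; case: (g \in cut s t [set w]).
Qed.

End DegreeTwo.

(** * The induction proving Edmonds' theorem *)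

Lemma half_pms_of_smaller s t S U x :
    (forall s' t' S' (y : E -> R), (#|S'| < #|S|)%N ->
      fractional_pm s' t' S' y -> convex_of_pms s' t' S' y) ->
    fractional_pm s t S x -> weight s t x U = 1 ->
    odd #|U :&: S| -> (1 < #|S :\: U|)%N -> convex_of_half_pms s t S U x.
Proof.
move=> IH xP xU1 oU SU; have /card_gt0P[c] : (0 < #|S :\: U|)%N by apply: ltnW.
rewrite inE => /andP[cU cS].
apply: (half_pms_of_contraction (c := c)) => // yP; apply: IH => //.
rewrite cardsU1 -(cardsID U S) inE (negbTE cU) andbF /=; lia.
Qed.

Lemma other_end s t S x e v : fractional_pm s t S x -> x e != 0 -> e \in cut s t [set v] ->
  exists u, [/\ u \in S, u != v & e \in cut s t [set u]].
Proof.
move=> [_ xS _ _] /xS[sS tS st]; rewrite !inE => ev.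
exists (if s e == v then t e else s e); move: ev; case: (eqVneq (s e) v) => [<-|sv] _.
  by rewrite !inE eqxx eq_sym st (negbTE st).
by split=> //; rewrite !inE eqxx [t e == _]eq_sym (negbTE st).
Qed.

Theorem fractional_pm_convex s t S x : fractional_pm s t S x -> convex_of_pms s t S x.
Proof.
have [n] := ubnP #|S|; elim: n s t S x => // n IHn s t S x; rewrite ltnS => Sn.
have IH s' t' S' (y : E -> R) : (#|S'| < #|S|)%N ->
    fractional_pm s' t' S' y -> convex_of_pms s' t' S' y.
  by move=> S'S; apply: IHn; apply: leq_trans S'S Sn.
have [k] := ubnP #|fsupp x|; elim: k x => // k IHk x; rewrite ltnS => xk xP.
have [S0|Sn0] := eqVneq S set0; first by move: xP; rewrite S0; apply: convex_of_pms_set0.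
have eS := fractional_pm_even xP.
have odd_compl U : odd #|U :&: S| -> odd #|~: U :&: S|.
  by move=> oU; move: eS; rewrite -(cardsID U S) oddD [S :&: U]setIC oU setDE setIC; case: odd.
have tight U (y : E -> R) : fractional_pm s t S y -> odd #|U :&: S| -> (1 < #|U :&: S|)%N ->
    (1 < #|S :\: U|)%N -> weight s t y U = 1 -> convex_of_pms s t S y.
  move=> yP oU c1 c2 yU; apply: (convex_of_pms_glue (U := U)).
    exact: (half_pms_of_smaller IH).
  apply: (half_pms_of_smaller IH) => //; rewrite ?weight_setC ?odd_compl //.
  by rewrite setDE setCK setIC.
case: (pickP (fun U : {set V} => [&& odd #|U :&: S|, (1 < #|U :&: S|)%N, (1 < #|S :\: U|)%N
    & weight s t x U == 1])) => [U /and4P[oU c1 c2 /eqP xU1]|no]; first exact: (tight U).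
(* No nontrivial odd cut is tight at [x]. Moving along [z] leads to a smaller support, covered by
   [IHk], or to a tight nontrivial odd cut, covered by [tight]. *)
have step (z : E -> R) : (forall e, z e != 0 -> x e != 0) ->
    (forall v, v \in S -> weight s t z [set v] = 0) -> (exists e, z e != 0) ->
    exists2 r : R, 0 < r & convex_of_pms s t S (fun e => x e + r * z e).
  move=> zx zv ze; have [U oU c1 c2|r [r0 yP]] := perturb xP _ zx zv ze.
    by apply/negP=> xU1; have := no U; rewrite oU c1 c2 xU1.
  case=> [lt|[U [oU c1 c2 yU]]]; exists r => //; last exact: (tight U).
  by apply: IHk => //; apply: leq_trans lt xk.
have line (z : E -> R) : (forall e, z e != 0 -> x e != 0) ->
    (forall v, v \in S -> weight s t z [set v] = 0) -> (exists e, z e != 0) ->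
    convex_of_pms s t S x.
  move=> zx zv [e ze]; have [r r0 rP] := step z zx zv (ex_intro _ e ze).
  have [|||q q0 qP] := step (fun e => - z e).
  - by move=> h; rewrite oppr_eq0; apply: zx.
  - by move=> v /zv; rewrite /weight sumrN => ->; rewrite oppr0.
  - by exists e; rewrite oppr_eq0.
  have rq : r + q != 0 by rewrite gt_eqF // addr_gt0.
  (* The point [x] lies on the segment from [x + r z] to [x - q z], which gives the coefficients. *)
  apply: (convex_of_pms_combine (a := q / (r + q)) (b := r / (r + q)) rP qP).
  - by rewrite divr_ge0 ?addr_ge0 ?ltW.
  - by rewrite divr_ge0 ?addr_ge0 ?ltW.
  - by field.
  by move=> h; field.
have [x0 xS xv xU] := xP.
case: (pickP (fun v => (v \in S) && (#|cut s t [set v] :&: fsupp x| <= 2)%N)) => [v /andP[vS]|deg3].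
  set D := _ :&: _ => D2.
  have inD h : h \in cut s t [set v] -> x h != 0 -> h \in D.
    by move=> hv xh; rewrite !inE in hv *; rewrite hv.
  have wD : \sum_(e in D) x e = 1.
    rewrite -(xv v vS) /weight [RHS](bigID (mem (fsupp x))) /= [X in _ = _ + X]big1 ?addr0.
      by apply: eq_bigl => h; rewrite inE.
    by move=> h /andP[_]; rewrite inE negbK => /eqP.
  case D0 : #|D| D2 => [|[|[|//]]] _.
  - by move: wD; rewrite (cards0_eq D0) big_set0 => /esym/eqP; rewrite oner_eq0.
  - have /eqP/cards1P[e De] := D0; rewrite De big_set1 in wD.
    apply: (convex_of_pms_remove xP wD) => yP; apply: IH yP.
    have [sS _ _] : [/\ s e \in S, t e \in S & s e != t e] by apply: xS; rewrite wD oner_eq0.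
    apply: proper_card; apply/properP; split; first exact: subsetDl.
    by exists (s e); rewrite // !inE eqxx.
  have /eqP/cards2P[e [f [ef De]]] := D0.
  have /setIP[ev] : e \in D by rewrite De !inE eqxx.
  have /setIP[fv] : f \in D by rewrite De !inE eqxx orbT.
  rewrite !inE => xf xe.
  have [u [uS uv eu]] := other_end xP xe ev; have [w [wS wv fw]] := other_end xP xf fv.
  have [uw|uw] := eqVneq u w.
    (* The edges [e] and [f] are parallel, so the difference of their indicators has weight 0 at
       every vertex. *)
    rewrite -uw in fw; pose z h : R := (h == e)%:R - (h == f)%:R.
    apply: (line z).
    - move=> h; rewrite /z; case: (eqVneq h e) => [->//|_]; case: (eqVneq h f) => [->//|_].
      by rewrite subrr eqxx.
    - move=> a aS; rewrite /weight /z big_split sumrN /=.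
      have cnt g : \sum_(h in cut s t [set a]) (h == g)%:R = (g \in cut s t [set a])%:R :> R.
        by rewrite big_mkcond (bigD1 g) //= eqxx big1 ?addr0 => [|h /negbTE->];
            rewrite ?if_same //; case: ifP.
      rewrite !cnt !inE.
      have [[-> ->]|[-> ->]] := joins_cut eu ev uv; have [[-> ->]|[-> ->]] := joins_cut fw fv uv;
        rewrite ?[(v == a) == _]eq_sym subrr //.
    by exists e; rewrite /z eqxx (negbTE ef) subr0 oner_eq0.
  have vef h : h \in cut s t [set v] -> x h != 0 -> (h == e) || (h == f).
    by move=> hv xh; have := inD _ hv xh; rewrite De !inE.
  have vw : v != w by rewrite eq_sym.
  have U3 : #|[set u; v; w]| = 3%N.
    by rewrite setUC cardsU1 cards2 uv !inE ![w == _]eq_sym (negbTE uw) (negbTE vw).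
  have US : [set u; v; w] :&: S = [set u; v; w].
    by apply/setIidPl/subsetP=> a; rewrite !inE => /orP[/orP[]|]/eqP->.
  apply: (convex_of_pms_glue (U := [set u; v; w])).
    exact: (degree_two_half xP uS vS wS uv vw uw eu ev fv fw vef).
  apply: (half_pms_of_smaller IH) => //.
  - by rewrite weight_setC (degree_two_tight xP uS vS wS uv vw uw eu ev fv fw vef).
  - by rewrite odd_compl // US U3.
  by rewrite setDE setCK setIC US U3.
(* All degrees in the support are now at least three, so counting ends gives
   [#|S| * 3 <= #|fsupp x| * 2]. As [S] is nonempty, there are more support edges than vertex
   equations. *)
have [|z [zx ze zv]] := @exists_kernel (fsupp x) S (fun v e => (e \in cut s t [set v])%:R).
  have sumE : (\sum_(v in S) \sum_(e in cut s t [set v]) (x e != 0)%R = #|fsupp x| * 2)%N.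
    have nzP e : ((x e != 0) : nat) != 0%N -> s e != t e.
      by have [_|/xS[] //] := eqVneq (x e) 0.
    rewrite [LHS](sum_cut1 (M := nat) S nzP).
    rewrite -sum1_card big_distrl /= big_mkcond [RHS]big_mkcond; apply: eq_bigr => e _.
    by rewrite inE; have [_|/xS[-> -> _]] := eqVneq (x e) 0; rewrite ?mul0rn.
  suff : (#|S| * 3 <= #|fsupp x| * 2)%N by rewrite -card_gt0 in Sn0; lia.
  rewrite -sumE.
  rewrite -sum_nat_const; apply: leq_sum => v vS.
  have := deg3 v; rewrite vS /= => /negbT; rewrite -ltnNge => /leq_trans-> //.
  rewrite -sum1_card [X in (_ <= X)%N]big_mkcond [X in (X <= _)%N]big_mkcond /=.
  by apply: leq_sum => e _; rewrite in_setI [e \in fsupp _]inE; case: (e \in _).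
apply: (line z).
- by move=> e; apply: contraNneq => xe; apply/eqP/zx; rewrite inE xe eqxx.
- move=> v vS; rewrite -[RHS](zv v vS) /weight big_mkcond; apply: eq_bigr => e _.
  by case: ifP; rewrite ?mul1r ?mul0r.
exact: ze.
Qed.

End PerfectMatchingPolytope.

(** * Parity of cuts, and auxiliary facts on sequences and edges *)

(** Edges inside [U] are counted at both ends and vanish modulo 2. *)
Lemma odd_sum_cut1 (E V : finType) (s t : E -> V) (U : {set V}) (z : E -> nat) :
    (forall e, z e != 0%N -> s e != t e) ->
  odd (\sum_(v in U) \sum_(e in cut s t [set v]) z e) = odd (\sum_(e in cut s t U) z e).
Proof.
move=> zP; rewrite [X in odd X](sum_cut1 (M := nat) U zP) [in RHS]big_mkcond.
apply: (big_rec2 (fun a b => odd a = odd b)) => // e a b _ ab.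
rewrite inE !oddD ab; congr (_ (+) _).
by case: (s e \in U); case: (t e \in U); rewrite ?oddD ?addbb.
Qed.

Lemma mem_flatten_uniq (T : eqType) (ss : seq (seq T)) (a : T) (p q : seq T) :
  uniq (flatten ss) -> p \in ss -> q \in ss -> a \in p -> a \in q -> p = q.
Proof.
elim: ss => //= r ss IH; rewrite cat_uniq => /and3P[_ /hasPn rss uss].
have out q' : q' \in ss -> a \in q' -> a \in r -> False.
  by move=> q's aq; have /negP := rss a (introT flattenP (ex_intro2 _ _ q' q's aq)).
rewrite !inE => /orP[/eqP->|ps] /orP[/eqP->|qs] // ap aq.
- by case: (out q).
- by case: (out p).
exact: IH.
Qed.

Lemma mem_bigcup_seq (T : finType) (I : eqType) (r : seq I) (F : I -> {set T}) a :
  reflect (exists2 i, i \in r & a \in F i) (a \in \bigcup_(i <- r) F i).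
Proof.
apply: (iffP idP) => [|[i]].
  elim: r => [|i r IH]; rewrite ?big_nil ?big_cons inE // => /orP[ai|/IH[j jr aj]].
    by exists i; rewrite ?mem_head.
  by exists j; rewrite // inE jr orbT.
elim: r => //= j r IH; rewrite big_cons !inE => /orP[/eqP->-> //|ir ai].
by rewrite IH ?orbT.
Qed.

Lemma edge_ends (V : finType) (e : {set V}) v :
  e \in edges V -> v \in e -> exists2 u, u != v & e = [set v; u].
Proof.
rewrite inE => /cards2P[a [b [ab ->]]]; rewrite !inE => /orP[]/eqP->.
  by exists b; rewrite // eq_sym.
by exists a; rewrite // setUC.
Qed.

(** * Paths, cycles and components in the complete graph *)

Section CompleteGraph.
Variable V : finType.
Implicit Types (e : {set V}) (p : seq V).

Lemma path_edges_cons2 a b p :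
  path_edges [:: a, b & p] = [set a; b] |: path_edges (b :: p).
Proof. by apply/setP=> e; rewrite /path_edges /= set_cons. Qed.

Lemma path_edges_sub p e : e \in path_edges p -> {subset e <= p}.
Proof.
case: p => [|a p]; first by rewrite /path_edges /= set_nil inE.
elim: p a => [|b p IH] a; first by rewrite /path_edges /= set_nil inE.
rewrite path_edges_cons2 in_setU1 => /orP[/eqP->|ep] v.
  by rewrite !inE => /orP[]/eqP->; rewrite eqxx ?orbT.
by move=> ve; rewrite inE (IH b ep v ve) orbT.
Qed.

(** Links [cycle_edges], defined by rotation, to the cyclic successor [next]. *)
Lemma nth_rot1 p a i : uniq p -> (i < size p)%N ->
  nth a (rot 1 p) i = next p (nth a p i).
Proof.
move=> up ip; rewrite next_nth mem_nth // index_uniq //; case: p {up} ip => // b p /= ip.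
(* At the last index both sides are the head [b]: rotation puts it at the end, and in [next] it is
   the default value of [nth]. *)
rewrite rot1_cons nth_rcons; move: ip; rewrite ltnS leq_eqVlt => /orP[/eqP->|ip].
  by rewrite ltnn eqxx nth_default.
by rewrite ip; apply: set_nth_default.
Qed.

Lemma cycle_edges_mem p e v : uniq p -> e \in cycle_edges p -> v \in e ->
  (v \in p) && (e \in [set [set v; next p v]; [set prev p v; v]]).
Proof.
move=> up; rewrite inE => /mapP[q /(nthP (v, v))[i]].
rewrite size_zip size_rot minnn => ip; rewrite nth_zip ?size_rot // nth_rot1 // => <- -> /=.
move: (nth v p i) (mem_nth v ip) => a ap; rewrite in_set2 => /orP[]/eqP->.
  by rewrite ap !inE eqxx.
by rewrite mem_next ap prev_next // !inE eqxx orbT.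
Qed.

Lemma cycle_edges_next p v : uniq p -> v \in p -> [set v; next p v] \in cycle_edges p.
Proof.
move=> up vp; rewrite inE; apply/mapP; exists (v, next p v) => //.
have ip : (index v p < size p)%N by rewrite index_mem.
apply/(nthP (v, v)); exists (index v p); first by rewrite size_zip size_rot minnn.
by rewrite nth_zip ?size_rot // nth_rot1 // nth_index.
Qed.

Lemma component_id (F : {set {set V}}) v : v \in component F v.
Proof. by rewrite inE connect0. Qed.

Lemma component_eq (F : {set {set V}}) u v : u \in component F v -> component F u = component F v.
Proof.
have sym : connect_sym (adj F).
  by apply: sym_connect_sym => a b; rewrite /adj /= setUC.
by rewrite inE => vu; apply/setP=> w; rewrite !inE (same_connect sym vu).
Qed.

Lemma component_adj (F : {set {set V}}) u v : [set u; v] \in F -> v \in component F u.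
Proof. by move=> uv; rewrite inE connect1. Qed.

Lemma mem_components (F : {set {set V}}) C v : C \in components F -> v \in C -> C = component F v.
Proof. by case/imsetP=> u _ -> /component_eq->. Qed.

Lemma card_component_ge3 (F : {set {set V}}) e f (v : V) :
    F \subset edges V -> e \in F -> f \in F -> e != f -> v \in e -> v \in f ->
  (3 <= #|component F v|)%N.
Proof.
move=> /subsetP FE eF fF ef ve vf.
have [a av eE] := edge_ends (FE _ eF) ve; have [b bv fE] := edge_ends (FE _ fF) vf.
have ab : a != b by apply: contraNneq ef => ab; rewrite eE fE ab.
have -> : 3%N = #|[set v; a; b]|.
  by rewrite setUC cardsU1 cards2 !inE negb_or bv [b == a]eq_sym ab eq_sym av.
apply/subset_leq_card/subsetP=> w; rewrite !in_setU !in_set1 => /orP[/orP[]|]/eqP->.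
- exact: component_id.
- by apply: component_adj; rewrite -eE.
- by apply: component_adj; rewrite -fE.
Qed.

End CompleteGraph.

(** * Half edges, full edges and paths in the support *)

Section SupportStructure.
Variables (R : realFieldType) (V : finType) (x : {set V} -> R).
Hypotheses (xfeas : lp_feasible x) (xstruct : balinski_structure x).
Implicit Types (e : {set V}) (v u w : V) (p : seq V).

Lemma supp_edges e : e \in supp x -> e \in edges V.
Proof. by rewrite inE => /andP[]. Qed.

Lemma edges_in_component e v : e \in supp x -> v \in e ->
  e \in edges_in (supp x) (component (supp x) v).
Proof.
move=> es ve; rewrite inE es /=; have [u _ eE] := edge_ends (supp_edges es) ve.
rewrite eE in es *; apply/subsetP=> w; rewrite in_set2 => /orP[]/eqP->.
  exact: component_id.
exact: component_adj.
Qed.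

Definition half_edges : {set {set V}} := [set e in supp x | x e == 1 / 2].
Definition full_edges : {set {set V}} := [set e in supp x | x e == 1].
Definition half_at v : {set {set V}} := [set e in half_edges | v \in e].
Definition full_at v : {set {set V}} := [set e in full_edges | v \in e].
(** By the structure of the components these are the vertices of the odd cycles, hence the vertices
    of the cubic multigraph. *)
Definition half_vertices : {set V} := [set v | half_at v != set0].

Lemma half_neq1 : (1 / 2 : R) != 1.
Proof. by apply/eqP => h; lra. Qed.

Lemma half_notin_full e : e \in half_edges -> e \notin full_edges.
Proof. by rewrite !inE => /andP[_ /eqP->]; rewrite (negbTE half_neq1) andbF. Qed.

Lemma half_vertexP v : reflect (exists2 e, e \in half_edges & v \in e) (v \in half_vertices).
Proof.
rewrite inE; apply: (iffP (set0Pn _)) => [[e]|[e eh ve]].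
  by rewrite inE => /andP[]; exists e.
by exists e; rewrite inE eh.
Qed.

Lemma comp_mem v : component (supp x) v \in components (supp x).
Proof. exact: imset_f. Qed.

Lemma supp_half_or_full e : e \in supp x -> (e \in half_edges) || (e \in full_edges).
Proof.
move=> es; have /card_gt0P[v ve] : (0 < #|e|)%N.
  by have := supp_edges es; rewrite inE => /eqP->.
rewrite [e \in half_edges]in_set [e \in full_edges]in_set es /=.
have := edges_in_component es ve.
case: (xstruct (comp_mem v)) => [[p [_ _ -> h]]|[cs [ps [_ _ _ -> [hc hp]]]]].
  by move/h->; rewrite eqxx orbT.
by rewrite inE => /orP[]/mem_bigcup_seq[p pc  ep]; [ rewrite (hc p) ?eqxx | rewrite (hp p) ?eqxx ?orbT].
Qed.

Lemma half_atP e v : (e \in half_at v) = [&& e \in supp x, x e == 1 / 2 & v \in e].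
Proof. by rewrite in_set [e \in half_edges]in_set andbA. Qed.

Lemma full_atP e v : (e \in full_at v) = [&& e \in supp x, x e == 1 & v \in e].
Proof. by rewrite in_set [e \in full_edges]in_set andbA. Qed.

(** The half edges at [v] all lie on cycles of its component. These cycles are disjoint, so a single
    one passes through [v], and there it has only the edges to the next and the previous vertex. *)
Lemma half_at_le2 v : (#|half_at v| <= 2)%N.
Proof.
have [->|/set0Pn[e0]] := eqVneq (half_at v) set0; first by rewrite cards0.
case: (xstruct (comp_mem v)) => [[p [_ _ E h]]|[cs [ps [[cyc ucs] _ _ E [hc hp]]]]].
  rewrite half_atP => /and3P[es /eqP xe ve]; have := edges_in_component es ve.
  by rewrite E => /h; rewrite xe => /eqP; rewrite (negbTE half_neq1).
have inc e : e \in half_at v -> exists p, [/\ p \in cs, uniq p & e \in cycle_edges p].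
  rewrite half_atP => /and3P[es /eqP xe ve]; have := edges_in_component es ve.
  rewrite E inE => /orP[]/mem_bigcup_seq[p pc ep].
    by exists p; split=> //; have /andP[/andP[]] := cyc p pc.
  by have /eqP := hp p pc e ep; rewrite xe (negbTE half_neq1).
move=> e0h; have [p [pc up e0p]] := inc _ e0h.
have ve0 : v \in e0 by move: e0h; rewrite half_atP => /and3P[].
have /andP[vp _] := cycle_edges_mem up e0p ve0.
suff sub : half_at v \subset [set [set v; next p v]; [set prev p v; v]].
  by rewrite (leq_trans (subset_leq_card sub)) // cards2; case: eqP.
apply/subsetP=> e eh; have [q [qc uq eq]] := inc _ eh.
have ve : v \in e by move: eh; rewrite half_atP => /and3P[].
have /andP[vq] := cycle_edges_mem uq eq ve.
by rewrite (mem_flatten_uniq ucs qc pc vq vp).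
Qed.

Lemma sum_delta (M : nmodType) (F : {set V} -> M) v :
    (forall e, e \notin supp x -> F e = 0) ->
  \sum_(e in delta v) F e = \sum_(e in half_at v) F e + \sum_(e in full_at v) F e.
Proof.
move=> F0; have sub e : e \in supp x -> v \in e -> e \in delta v.
  by move=> /supp_edges es ve; rewrite inE es.
rewrite (bigID (mem (half_at v))) /=; congr (_ + _).
  apply: eq_bigl => e; apply: andb_idl; rewrite half_atP => /and3P[es _ ve]; exact: sub.
rewrite (bigID (mem (full_at v))) /= [X in _ + X]big1 ?addr0; last first.
  move=> e /andP[/andP[]]; rewrite inE => /andP[_ ve] eh ef; apply: F0.
  apply/negP => es; have := supp_half_or_full es; rewrite !in_set in eh ef *.
  by rewrite ve !andbT in eh ef; rewrite (negbTE eh) (negbTE ef).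
apply: eq_bigl => e; apply: andb_idl; rewrite [e \in full_at v]in_set => /andP[ef ve].
rewrite [e \in half_at v]in_set ve andbT; apply/andP; split; last first.
  by apply: contraL ef; apply: half_notin_full.
by apply: sub => //; move: ef; rewrite inE => /andP[].
Qed.

Lemma supp_eq0 e : e \in edges V -> e \notin supp x -> x e = 0.
Proof.
move=> ee; rewrite in_set ee /= -leNgt => x0.
by apply: le_anti; rewrite x0; have /andP[] := xfeas.2 e ee.
Qed.

(** With [h] half and [f] full edges at [v], the degree equation is [h + 2 f = 4]; since [h <= 2],
    the pair is (2, 1) or (0, 2). *)
Lemma degrees v : if v \in half_vertices then #|half_at v| = 2%N /\ #|full_at v| = 1%N
  else half_at v = set0 /\ #|full_at v| = 2%N.
Proof.
have sum2 : (#|half_at v| + #|full_at v| * 2 = 4)%N.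
  apply/eqP; rewrite -(eqr_nat R) natrD natrM.
  suff : \sum_(e in delta v) x e = #|half_at v|%:R / 2 + #|full_at v|%:R.
    by rewrite (xfeas.1 v) => h; apply/eqP; lra.
  (* Off [edges V] the values of [x] are arbitrary, while [sum_delta] needs a function vanishing off
     the support. *)
  pose F e := if e \in edges V then x e else 0.
  rewrite (eq_bigr F); last by move=> e; rewrite inE /F => /andP[->].
  rewrite sum_delta; last by move=> e es; rewrite /F; case: ifP => // ee; apply: supp_eq0.
  rewrite (eq_bigr (fun=> 1 / 2)); last first.
    by move=> e; rewrite half_atP /F => /and3P[/supp_edges-> /eqP].
  rewrite [X in _ + X](eq_bigr (fun=> 1)); last first.
    by move=> e; rewrite full_atP /F => /and3P[/supp_edges-> /eqP].
  by rewrite !sumr_const -mulr_natr; ring.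
have nums (a b : nat) : (a + b * 2 = 4 -> a <= 2 ->
    if a == 0 then b = 2 else a = 2 /\ b = 1)%N by case: eqP => ?; lia.
have := nums _ _ sum2 (half_at_le2 v); rewrite inE cards_eq0.
by case: (eqVneq (half_at v) set0).
Qed.

(** An integer component has no half vertex and gets no path. In a fractional component the cycle
    vertices are exactly the half vertices, so the paths can be said to join half vertices without
    mentioning the cycles. *)
Lemma component_paths C : C \in components (supp x) -> exists ps : seq (seq V),
  [/\ uniq (flatten ps),
      {in ps, forall p, joining_path (enum half_vertices) p},
      {in ps, forall p, {in path_edges p, forall e, path_edge x C e}},
      {in ps, forall p, {subset p <= C}}
    & (ps = [::] /\ {in C, forall v, v \notin half_vertices}) \/
      {in full_edges, forall e, e \subset C -> exists2 p, p \in ps & e \in path_edges p}].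
Proof.
move=> CC; have atC e v : e \in supp x -> v \in e -> v \in C -> e \in edges_in (supp x) C.
  by move=> es ve vC; rewrite (mem_components CC vC) edges_in_component.
case: (xstruct CC) => [[p [_ _ E h]]|fC].
  exists [::]; split=> //; left; split=> // v vC; apply/half_vertexP => -[e].
  rewrite inE => /andP[es /eqP xe] ve; have := atC e v es ve vC.
  by rewrite E => /h; rewrite xe => /eqP; rewrite (negbTE half_neq1).
have [cs [ps [[cyc ucs] [jps ups] CE E [hc hp]]]] := fC.
have csW v : v \in C -> (v \in flatten cs) = (v \in half_vertices).
  move=> vC; apply/flattenP/half_vertexP => [[p pc vp]|[e]].
    have /andP[/andP[up _] _] := cyc p pc; have ep := cycle_edges_next up vp.
    exists [set v; next p v]; last exact: set21.
    rewrite inE (hc p pc _ ep) eqxx andbT.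
    have : [set v; next p v] \in edges_in (supp x) C.
      by rewrite E inE; apply/orP; left; apply/mem_bigcup_seq; exists p.
    by rewrite inE => /andP[].
  rewrite inE => /andP[es /eqP xe] ve; have := atC e v es ve vC.
  rewrite E inE => /orP[]/mem_bigcup_seq[p pc ep].
    have /andP[/andP[up _] _] := cyc p pc.
    by exists p => //; have /andP[] := cycle_edges_mem up ep ve.
  by have /eqP := hp p pc e ep; rewrite xe (negbTE half_neq1).
have psC p : p \in ps -> {subset p <= C}.
  by move=> pp v vp; rewrite CE mem_cat; apply/orP; right; apply/flattenP; exists p.
exists ps; split=> // [p pp|p pp e ep|].
- have [a [s [b [pE up aW bW sW]]]] := jps p pp; exists a, s, b.
  have inC v : v \in p -> v \in C by apply: psC.
  have aC : a \in C by apply: inC; rewrite pE mem_head.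
  have bC : b \in C by apply: inC; rewrite pE inE mem_rcons mem_head orbT.
  split=> //; rewrite ?mem_enum -?csW // => v vs; rewrite mem_enum -csW ?sW //.
  by apply: inC; rewrite pE inE mem_rcons inE vs !orbT.
- split=> //; last exact: hp ep.
  by rewrite E inE; apply/orP; right; apply/mem_bigcup_seq; exists p.
right=> e; rewrite inE => /andP[es /eqP xe] eC.
have : e \in edges_in (supp x) C by rewrite inE es.
rewrite E inE => /orP[]/mem_bigcup_seq[p pc ep]; last by exists p.
by have /eqP := hc p pc e ep; rewrite xe eq_sym (negbTE half_neq1).
Qed.

(* [P v] is the path of value-1 edges through [v], and is empty on the integer
   components. *)
Definition path_system (P : V -> seq V) : Prop :=
  [/\ forall v u, u \in P v -> P u = P v,
      forall v, P v != [::] -> v \in P v /\ joining_path (enum half_vertices) (P v),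
      forall v, v \in half_vertices -> P v != [::],
      forall v e, e \in path_edges (P v) -> path_edge x (component (supp x) v) e
    & forall v e, e \in full_at v -> P v != [::] -> e \in path_edges (P v)].

Lemma path_system_exists : exists P, path_system P.
Proof.
have [C|ps psP] := @fin_all_exists _ (fun=> seq (seq V)) (fun C ps =>
    C \in components (supp x) -> [/\ uniq (flatten ps),
      {in ps, forall p, joining_path (enum half_vertices) p},
      {in ps, forall p, {in path_edges p, forall e, path_edge x C e}},
      {in ps, forall p, {subset p <= C}}
    & (ps = [::] /\ {in C, forall v, v \notin half_vertices}) \/
      {in full_edges, forall e, e \subset C -> exists2 p, p \in ps & e \in path_edges p}]).
  have [CC|_] := boolP (C \in components (supp x)); last by exists [::].
  by have [ps psP] := component_paths CC; exists ps.
pose K v := component (supp x) v.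
(* If no path of the component contains [v], then [find] returns the length of the list and [nth]
   its default [[::]]. *)
pose P v := nth [::] (ps (K v)) (find (fun p => v \in p) (ps (K v))).
have Pmem v : P v != [::] -> P v \in ps (K v) /\ v \in P v.
  rewrite /P; have [hv _|hv] := boolP (has (fun p => v \in p) (ps (K v))).
    split; last exact: (nth_find [::] hv).
    by rewrite mem_nth // -has_find.
  by rewrite hasNfind // nth_default ?eqxx.
have PE v p : p \in ps (K v) -> v \in p -> P v = p.
  move=> pp vp; have [ups _ _ _ _] := psP _ (comp_mem v).
  have hv : has (fun p => v \in p) (ps (K v)) by apply/hasP; exists p.
  have [|Pp vP] := Pmem v.
    by have := nth_find [::] hv; rewrite -/(P v); case: (P v).
  exact: mem_flatten_uniq ups Pp pp vP vp.
have nonempty (p : seq V) v : v \in p -> p != [::] by case: p.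
exists P; split.
- move=> v u uP; have [Pp vP] := Pmem v (nonempty _ _ uP).
  have [_ _ _ pC _] := psP _ (comp_mem v).
  have KuE : K u = K v by apply: component_eq; apply: pC Pp _ uP.
  by apply: PE; rewrite ?KuE.
- move=> v Pv; have [Pp vP] := Pmem v Pv; split=> //.
  by have [_ jp _ _ _] := psP _ (comp_mem v); apply: jp.
- move=> v vW; have := degrees v; rewrite vW => -[_ K1].
  have /card_gt0P[e] : (0 < #|full_at v|)%N by rewrite K1.
  rewrite full_atP => /and3P[es xe ve].
  have [_ _ _ _ [[_ /(_ v (component_id _ v))]|hf]] := psP _ (comp_mem v); first by rewrite vW.
  have ef : e \in full_edges by rewrite in_set es.
  have eK : e \subset K v by have := edges_in_component es ve; rewrite inE => /andP[].
  have [p pp ep] := hf e ef eK.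
  have vp := path_edges_sub ep ve.
  by rewrite (PE v p pp vp) (nonempty _ _ vp).
- move=> v e ep; have ne : P v != [::].
    by apply: contraTneq ep => ->; rewrite /path_edges set_nil inE.
  have [Pp vP] := Pmem v ne; have [_ _ pe _ _] := psP _ (comp_mem v).
  exact: pe Pp _ ep.
move=> v e; rewrite full_atP => /and3P[es xe ve] ne; have [Pp vP] := Pmem v ne.
have [ups _ _ _ [[ps0 _]|hf]] := psP _ (comp_mem v); first by rewrite -/(K v) in ps0; rewrite ps0 in Pp.
have ef : e \in full_edges by rewrite in_set es.
have eK : e \subset K v by have := edges_in_component es ve; rewrite inE => /andP[].
have [p pp ep] := hf e ef eK.
by rewrite (PE v p pp (path_edges_sub ep ve)).
Qed.

(** * The cubic multigraph obtained by shrinking the paths *)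

Section Contraction.
Variables (P : V -> seq V) (v0 : V).
Hypothesis PP : path_system P.

Let Pmem := let: And5 h _ _ _ _ := PP in h.
Let Pjoin := let: And5 _ h _ _ _ := PP in h.
Let Phalf := let: And5 _ _ h _ _ := PP in h.
Let Pedge := let: And5 _ _ _ h _ := PP in h.
Let Pfull := let: And5 _ _ _ _ h := PP in h.

Definition path_end v := last v0 (P v).
Definition path_start v := head v0 (P v).
(** A path is named by its last vertex, so that each path contributes exactly one edge. *)
Definition path_ends : {set V} := [set b | (P b != [::]) && (b == path_end b)].

(* The cubic multigraph obtained by shrinking each path to a single edge: [inl e]
   is a half edge, [inr b] the path that ends at [b]. *)
Definition src (e : {set V} + V) : V :=
  match e with inl h => head v0 (enum h) | inr b => path_start b end.
Definition tgt (e : {set V} + V) : V :=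
  match e with inl h => last v0 (enum h) | inr b => b end.
Definition cubic_edge (e : {set V} + V) : bool :=
  match e with inl h => h \in half_edges | inr b => b \in path_ends end.

Lemma path_shape v : P v != [::] -> exists b p,
  [/\ P v = [:: path_start v, b & p], path_end v = last b p, uniq (P v),
      (path_start v \in half_vertices) && (path_end v \in half_vertices)
    & forall u, u \in P v -> u \in half_vertices ->
        (u == path_start v) || (u == path_end v)].
Proof.
rewrite /path_start /path_end => /Pjoin[_ [a [s [b [-> up]]]]].
rewrite !mem_enum => aW bW sW; exists (head b s), (behead (rcons s b)).
rewrite /= last_rcons aW bW; split=> //; first by case: s {up sW}.
  by case: s {up sW} => //= c s; rewrite last_rcons.
move=> u; rewrite inE mem_rcons inE => /or3P[->|->|/sW] //; rewrite ?orbT //.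
by rewrite mem_enum => /negbTE->.
Qed.

Lemma path_start_neq_end v : P v != [::] -> path_start v != path_end v.
Proof.
case/path_shape=> b [p [-> -> /= /andP[+ _] _ _]]; apply: contraNneq => ->.
exact: mem_last.
Qed.

Lemma eq_path_end u v : P u = P v -> path_end u = path_end v.
Proof. by rewrite /path_end => ->. Qed.

Lemma eq_path_start u v : P u = P v -> path_start u = path_start v.
Proof. by rewrite /path_start => ->. Qed.

Lemma path_end_mem v : P v != [::] -> path_end v \in P v.
Proof.
by case/path_shape=> b [p [-> -> _ _ _]]; rewrite inE mem_last orbT.
Qed.

Lemma path_start_mem v : P v != [::] -> path_start v \in P v.
Proof. by case/path_shape=> b [p [-> _ _ _ _]]; rewrite mem_head. Qed.

Lemma path_end_ends v : P v != [::] -> path_end v \in path_ends.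
Proof.
move=> nv; have E := Pmem (path_end_mem nv).
by rewrite inE E nv (eq_path_end E) eqxx.
Qed.

Lemma inl_cut e u w U : e = [set u; w] -> u != w ->
  (inl e \in cut src tgt U) = ((u \in U) != (w \in U)).
Proof.
move=> eE uw; rewrite inE /=.
have : size (enum e) = 2%N by rewrite -cardE eE cards2 uw.
have := enum_uniq e; have : {subset enum e <= [:: u; w]}.
  by move=> z; rewrite mem_enum eE !inE.
case: (enum e) => [|a [|b [|c l]]] //= sub; rewrite inE andbT => ab _.
have := sub a; have := sub b; rewrite !inE !eqxx !orbT => /(_ isT) hb /(_ isT) ha.
by case/orP: ha ab => /eqP->; case/orP: hb => /eqP->; rewrite ?eqxx // => _; rewrite eq_sym.
Qed.

Lemma cut1_inl h v : cubic_edge (inl h) && (inl h \in cut src tgt [set v]) = (h \in half_at v).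
Proof.
rewrite [h \in half_at v]in_set /=; apply: andb_id2l => hh.
have : h \in edges V by apply: supp_edges; move: hh; rewrite inE => /andP[].
rewrite inE => /cards2P[a [b [ab hE]]]; rewrite (inl_cut _ hE ab) hE !inE ![v == _]eq_sym.
by case: (eqVneq a v) ab => [->|_]; case: (eqVneq b v) => // ->; rewrite ?eqxx.
Qed.

Lemma cut1_inr b v : v \in half_vertices ->
  cubic_edge (inr b) && (inr b \in cut src tgt [set v]) = (b == path_end v).
Proof.
move=> vS; have nv := Phalf vS; apply/andP/eqP => [[]|bE].
  rewrite /= inE => /andP[nb /eqP bE]; rewrite inE /= !in_set1 => bv.
  suff vb : v \in P b by rewrite (eq_path_end (Pmem vb)).
  move: bv; case: (eqVneq (path_start b) v) => [<- _|_]; first exact: path_start_mem.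
  by case: (eqVneq b v) => // <- _; case: (Pjoin nb).
have Pb : P b = P v by rewrite bE; apply/Pmem/path_end_mem.
split; first by rewrite /= bE path_end_ends.
rewrite inE /= !in_set1 (eq_path_start Pb) bE.
have neq := path_start_neq_end nv; have [_ [_ [_ _ _ _ /(_ v)]]] := path_shape nv.
rewrite (Pjoin nv).1 vS => /(_ isT isT); rewrite ![v == _]eq_sym.
case: (eqVneq (path_start v) v) neq => [->|_ _] /=; last by case: (path_end v == v).
by rewrite eq_sym => /negbTE->.
Qed.

Lemma sum_cut1_cubic (F : {set V} + V -> nat) v : v \in half_vertices ->
  (\sum_(e in cut src tgt [set v] | cubic_edge e) F e =
   \sum_(h in half_at v) F (inl h) + F (inr (path_end v)))%N.
Proof.
move=> vS; rewrite big_sumType; congr addn.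
  by apply: eq_bigl => h; rewrite andbC cut1_inl.
by rewrite (eq_bigl (pred1 (path_end v))) ?big_pred1_eq // => b; rewrite andbC cut1_inr.
Qed.

Lemma cubic_ends (e : {set V} + V) : cubic_edge e ->
  [/\ src e \in half_vertices, tgt e \in half_vertices & src e != tgt e].
Proof.
case: e => [h|b] /= hh.
  have hV v : v \in h -> v \in half_vertices by move=> vh; apply/half_vertexP; exists h.
  have : size (enum h) = 2%N.
    rewrite -cardE; apply/eqP; have : h \in supp x by move: hh; rewrite inE => /andP[].
    by move/supp_edges; rewrite inE.
  have := enum_uniq h; have : {subset enum h <= h} by move=> v; rewrite mem_enum.
  case: (enum h) => [|a [|c [|]]] //= sub; rewrite inE andbT => ac _.
  by split=> //; apply/hV/sub; rewrite !inE eqxx ?orbT.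
move: hh; rewrite inE => /andP[nb /eqP bE]; have neq := path_start_neq_end nb.
by have [c [p [_ _ _ /andP[sS eS] _]]] := path_shape nb; rewrite -bE in eS neq.
Qed.

Definition cubic_weight (e : {set V} + V) : R := if cubic_edge e then 1 / 3 else 0.

Lemma weight_cubic U :
  weight src tgt cubic_weight U = (\sum_(e in cut src tgt U | cubic_edge e) 1)%:R / 3.
Proof.
rewrite /weight big_mkcondr /= natr_sum mulr_suml; apply: eq_bigr => e _.
by rewrite /cubic_weight; case: ifP => _; rewrite ?mul0r.
Qed.

(* The cut edge is the first edge of the path that ends at [b]. *)
Lemma cubic_cut_edge (U : {set V}) b : b \in path_ends -> inr b \in cut src tgt U ->
    (forall e : {set V} + V, cubic_edge e -> e \in cut src tgt U -> e = inr b) ->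
  exists e, cut_edge x e.
Proof.
move=> bB bU only; have /andP[nb /eqP bE] : (P b != [::]) && (b == path_end b) by rewrite inE in bB.
have [c [p [Pb _ uPb _ _]]] := path_shape nb; set a := path_start b in Pb.
have fP : [set a; c] \in path_edges (P b) by rewrite Pb path_edges_cons2 setU11.
have fE := Pedge fP; exists [set a; c], (component (supp x) b) => //.
have aP : a \in P b by rewrite Pb mem_head.
have cP : c \in P b by rewrite Pb !inE eqxx orbT.
have fC : [set a; c] \subset component (supp x) b.
  by case: fE => _ _; rewrite inE => /andP[].
exists a, c; split; try by apply: (subsetP fC); rewrite !inE eqxx ?orbT.
(* The map [g] pushes every vertex of a path except the first to its end, so a path separated by [U]
   leaves [T] only along its first edge. Only the path of [b] is separated; hence [T] is closed
   under all support edges but [[set a; c]], whose ends it separates. *)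
pose g v := if v == path_start v then v else path_end v.
pose T := [set v | (P v != [::]) && (g v \in U)].
have gS v : v \in half_vertices -> g v = v.
  move=> vS; have nv := Phalf vS; have [_ [_ [_ _ _ _ /(_ v)]]] := path_shape nv.
  by rewrite (Pjoin nv).1 vS /g => /(_ isT isT); case: eqP => //= _ /eqP.
have aT : (a \in T) != (c \in T).
  have ca : c != a by move: uPb; rewrite Pb /= inE negb_or eq_sym => /andP[/andP[]].
  rewrite !inE /g (eq_path_start (Pmem aP)) (eq_path_start (Pmem cP)) (eq_path_end (Pmem cP)).
  rewrite (Pmem aP) (Pmem cP) nb -/a eqxx (negbTE ca) -bE /=.
  by move: bU; rewrite inE.
have sym : connect_sym (adj (supp x :\ [set a; c])).
  by apply: sym_connect_sym => u v; rewrite /adj /= setUC.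
apply/negP=> /(closed_connect _) ac; case/negP: aT; apply/eqP/ac.
apply: intro_closed => // u w; rewrite /adj /= in_setD1 => /andP[neq es].
have uw : u != w.
  by have := supp_edges es; rewrite inE cards2; case: (u != w).
rewrite !inE => /andP[nu gu]; case/orP: (supp_half_or_full es) => eh.
  have uS : u \in half_vertices by apply/half_vertexP; exists [set u; w]; rewrite // set21.
  have wS : w \in half_vertices by apply/half_vertexP; exists [set u; w]; rewrite // set22.
  rewrite (Phalf wS) gS //; rewrite gS // in gu.
  have := only (inl [set u; w]) eh; rewrite (inl_cut _ erefl uw) gu.
  by case: (w \in U) => // /(_ isT).
have eP : [set u; w] \in path_edges (P u) by apply: Pfull; rewrite // inE eh set21.
have Pw : P w = P u by apply/Pmem/(path_edges_sub eP); rewrite set22.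
rewrite Pw nu; have [c' [p' [Pu eu uP' _ _]]] := path_shape nu.
have gE z : P z = P u -> g z = path_start u \/ g z = path_end u.
  move=> Pz; rewrite /g (eq_path_start Pz) (eq_path_end Pz).
  by case: eqP => [->|_]; [left | right].
have [ub|ub] := eqVneq (path_end u) b; last first.
  have := only (inr (path_end u)) (path_end_ends nu).
  rewrite inE /= (eq_path_start (Pmem (path_end_mem nu))) => hU.
  have {hU} sE : (path_start u \in U) = (path_end u \in U).
    by apply/eqP; apply: contraT => /hU[] /eqP; rewrite (negbTE ub).
  by case: (gE u erefl) gu => ->; case: (gE w Pw) => ->; rewrite ?sE.
have Pub : P u = P b by rewrite -ub; apply/esym/Pmem/path_end_mem.
have : [set u; w] \in path_edges (c :: p).
  by move: eP; rewrite Pub Pb path_edges_cons2 in_setU1 (negbTE neq).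
move/path_edges_sub => sub.
(* On the path of [b] itself, the edges other than the first avoid the start, so [g] sends both of
   their ends to [b]. *)
have gb z : z \in [set u; w] -> P z = P b -> g z = b.
  move=> /sub zp Pz; rewrite /g (eq_path_start Pz) (eq_path_end Pz) -bE.
  by case: eqP => // zE; rewrite zE -/a in zp; move: uPb; rewrite Pb /= zp.
by rewrite (gb w (set22 u w)) ?Pw // -(gb u (set21 u w)).
Qed.

Lemma cubic_fractional_pm : (forall e, ~ cut_edge x e) ->
  fractional_pm src tgt half_vertices cubic_weight.
Proof.
move=> nocut.
have nz k : cubic_weight k != 0 -> cubic_edge k by rewrite /cubic_weight; case: ifP; rewrite ?eqxx.
split=> [e|e /nz|v vS|U oU].
- by rewrite /cubic_weight; case: ifP => // _; lra.
- exact: cubic_ends.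
- rewrite weight_cubic sum_cut1_cubic // sum1_card.
  by have := degrees v; rewrite vS => -[-> _]; field.
have nzS k : cubic_weight k != 0 -> src k \in half_vertices /\ tgt k \in half_vertices.
  by move=> /nz/cubic_ends[].
rewrite -(weight_setI _ nzS); set U' := U :&: _ in oU *.
have U'S : U' \subset half_vertices by apply: subsetIr.
pose ish (e : {set V} + V) := if e is inl _ then true else false.
pose A := [set e in cut src tgt U' | cubic_edge e && ish e].
pose B := [set e in cut src tgt U' | cubic_edge e && ~~ ish e].
(* If every vertex meets [d] edges of a class [Q], the number of edges of [Q] crossing the odd set
   [U'] has the parity of [d]. The half edges have [d = 2], the paths [d = 1]. *)
have parity (Q : pred ({set V} + V)) d :
    {in half_vertices, forall v,
      (\sum_(h in half_at v) Q (inl h) + Q (inr (path_end v)))%N = d} ->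
  odd #|[set e in cut src tgt U' | cubic_edge e && Q e]| = odd d.
  move=> Qd; have -> : #|[set e in cut src tgt U' | cubic_edge e && Q e]| =
      (\sum_(e in cut src tgt U') (cubic_edge e && Q e))%N.
    by rewrite -sum1_card -[RHS]big_mkcondr; apply: eq_bigl => e; rewrite inE.
  rewrite -odd_sum_cut1; last by move=> e; rewrite eqb0 negbK => /andP[/cubic_ends[]].
  rewrite (eq_bigr (fun=> d)); last first.
    move=> v /(subsetP U'S) vS; rewrite -(Qd v vS) -(sum_cut1_cubic (fun k => Q k)) //.
    by rewrite [RHS]big_mkcondr; apply: eq_bigr => e _; case: (cubic_edge e).
  by rewrite sum_nat_const oddM oU.
have oA : ~~ odd #|A|.
  rewrite (parity ish 2%N) // => v vS /=; rewrite addn0 sum1_card.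
  by have := degrees v; rewrite vS => -[-> _].
have oB : odd #|B|.
  by rewrite (parity (predC ish) 1%N) // => v vS /=; rewrite big1.
have -> : weight src tgt cubic_weight U' = (#|A| + #|B|)%:R / 3.
  rewrite weight_cubic; congr (_%:R / 3).
  rewrite -sum1_card -[X in (_ = _ + X)%N]sum1_card (bigID ish) /=.
  by congr addn; apply: eq_bigl => e; rewrite [RHS]in_set andbA.
have [le3|lt3] := leqP 3 (#|A| + #|B|).
  by rewrite ler_pdivlMr ?ltr0n // mul1r ler_nat.
(* With [#|A|] even, [#|B|] odd and the sum below three, a single path crosses the cut, and this
   yields a cut edge. *)
have [A0 B1] : #|A| = 0%N /\ #|B| = 1%N.
  by move: (#|A|) (#|B|) oA oB lt3 => [|[|[|k]]] [|[|[|j]]].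
have /eqP/cards1P[b Bb] := B1; have : b \in B by rewrite Bb set11.
rewrite in_set => /and3P[bU bc bi]; case: b Bb bU bc bi => // b Bb bU bc _.
have [|e] := cubic_cut_edge bc bU; last by move/nocut.
move=> e ec eU; have [ei|ei] := boolP (ish e).
  have : e \in A by rewrite in_set eU ec.
  by rewrite (cards0_eq A0) inE.
have : e \in B by rewrite in_set eU ec.
by rewrite Bb inE => /eqP.
Qed.

(** * From a perfect matching to a graphical 2-matching *)

Definition doubled (N : {set {set V} + V}) v : bool := (P v != [::]) && (inr (path_end v) \in N).

Definition g2m_of_pm (N : {set {set V} + V}) (e : {set V}) : nat :=
  if e \in half_edges then nat_of_bool (inl e \notin N)
  else if e \in full_edges then [exists v in e, doubled N v].+1 else 0%N.

Lemma g2m_half N e : e \in half_edges -> g2m_of_pm N e = (inl e \notin N).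
Proof. by rewrite /g2m_of_pm => ->. Qed.

(** All ends of [e] that lie on some path lie on the same one, so any end decides whether [e] is
    doubled. *)
Lemma g2m_full N e v : e \in full_at v -> g2m_of_pm N e = (doubled N v).+1.
Proof.
move=> efv; move: (efv); rewrite in_set => /andP[ef ve].
have -> : g2m_of_pm N e = [exists v in e, doubled N v].+1.
  by rewrite /g2m_of_pm ef; case: ifP => // /half_notin_full; rewrite ef.
congr (nat_of_bool _).+1; apply/existsP/idP => [[u /andP[ue /andP[nu uN]]]|dv]; last first.
  by exists v; rewrite ve.
have efu : e \in full_at u by rewrite in_set ef.
have Pv : P v = P u by apply/Pmem/(path_edges_sub (Pfull efu nu)).
by rewrite /doubled Pv nu (eq_path_end Pv).
Qed.

Lemma g2m_out N e : e \notin supp x -> g2m_of_pm N e = 0%N.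
Proof.
move=> es; rewrite /g2m_of_pm.
by rewrite [e \in half_edges]in_set [e \in full_edges]in_set (negbTE es).
Qed.

(** A half vertex matched by a half edge keeps one half edge and one single path edge, degree 2;
    matched by its path, it keeps two half edges and a doubled path edge, degree 4. Any other vertex
    has two full edges, both single or both doubled. Each vertex thus meets two distinct edges,
    which makes its component large enough. *)
Lemma g2m_of_pmP (N : {set {set V} + V}) : (forall k, k \in N -> cubic_edge k) ->
    {in half_vertices, forall v, #|N :&: cut src tgt [set v]| = 1%N} ->
  is_G2M (g2m_of_pm N).
Proof.
move=> Nc N1.
have N1v v : v \in half_vertices ->
    (\sum_(h in half_at v) (inl h \in N) + (inr (path_end v) \in N) = 1)%N.
  move=> vS; rewrite -(N1 v vS) -(sum_cut1_cubic (fun k => k \in N)) //.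
  rewrite -sum1_card -[LHS]big_mkcondr; apply: eq_bigl => e.
  by rewrite in_setI [RHS]andbC -andbA; congr (_ && _); apply: andb_idl; apply: Nc.
have unmatched v : v \in half_vertices ->
    (\sum_(h in half_at v) (inl h \notin N) = (doubled N v).+1)%N.
  move=> vS; have := N1v v vS; rewrite /doubled Phalf //= => sum1.
  have : (\sum_(h in half_at v) (inl h \in N) + \sum_(h in half_at v) (inl h \notin N) = 2)%N.
    rewrite -big_split /= (eq_bigr (fun=> 1%N)); last by move=> h _; case: (_ \in N).
    by rewrite sum1_card; have := degrees v; rewrite vS => -[].
  by move: sum1; case: (inr _ \in N) => /=; lia.
have mhalf v : (\sum_(e in half_at v) g2m_of_pm N e = \sum_(h in half_at v) (inl h \notin N))%N.
  by apply: eq_bigr => h; rewrite in_set => /andP[/g2m_half->].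
have mfull v : (\sum_(e in full_at v) g2m_of_pm N e = #|full_at v| * (doubled N v).+1)%N.
  by rewrite -sum_nat_const; apply: eq_bigr => e /g2m_full->.
split=> [v|e _|_ /imsetP[v _ ->]].
- rewrite [X in X \in _](sum_delta (M := nat)); last by move=> e; apply: g2m_out.
  rewrite [X in X \in _](_ : _ = (\sum_(e in half_at v) g2m_of_pm N e +
    \sum_(e in full_at v) g2m_of_pm N e)%N) // mhalf mfull.
  have := degrees v; case: ifP => [vS [_ ->]|_ [-> ->]].
    by rewrite unmatched //; case: doubled.
  by rewrite big_set0; case: doubled.
- rewrite /g2m_of_pm; case: ifP => _; first by case: (_ \notin _).
  by case: ifP => _ //; rewrite ltnS leq_b1.
have ms e : (0 < g2m_of_pm N e)%N -> e \in multiset_support (g2m_of_pm N).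
  move=> me; rewrite inE me andbT; apply: supp_edges.
  by apply: contraLR me => /(g2m_out N)->.
have mE : multiset_support (g2m_of_pm N) \subset edges V.
  by apply/subsetP=> e; rewrite inE => /andP[].
have fullms e : e \in full_at v -> e \in multiset_support (g2m_of_pm N).
  by move=> ef; apply: ms; rewrite (g2m_full N ef).
have atv e : e \in full_at v -> v \in e by rewrite inE => /andP[].
have := degrees v; case: ifP => [vS [_ K1]|_ [_ K2]]; last first.
  have /eqP/cards2P[e [f [ef KE]]] := K2.
  have eK : e \in full_at v by rewrite KE set21.
  have fK : f \in full_at v by rewrite KE set22.
  by apply: (card_component_ge3 mE (fullms e eK) (fullms f fK) ef); apply: atv.
have /eqP/cards1P[f KE] := K1; have fK : f \in full_at v by rewrite KE set11.
have [h /andP[hv hN]] : exists h, (h \in half_at v) && (inl h \notin N).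
  apply/existsP; apply: contra_eqT (unmatched v vS) => no.
  rewrite big1 // => h hv; apply/eqP; rewrite eqb0; apply: contra no => hN.
  by apply/existsP; exists h; rewrite hv.
move: hv; rewrite in_set => /andP[hh vh].
have hm : h \in multiset_support (g2m_of_pm N) by apply: ms; rewrite g2m_half // hN.
apply: (card_component_ge3 mE hm (fullms f fK) _ vh (atv f fK)).
move: fK; rewrite in_set => /andP[ff _].
by apply: contraTneq hh => ->; apply: contraL ff; apply: half_notin_full.
Qed.

(** Each edge of the multigraph is matched with probability 1/3. A half edge has mean multiplicity
    [1 - 1/3 = 4/3 * 1/2], a path edge [1 + 1/3], and an edge on no path 1. *)
Lemma mean_g2m_le (I : finType) (l : I -> R) (N : I -> {set {set V} + V}) e :
    \sum_i l i = 1 -> (forall k, \sum_(i | k \in N i) l i = cubic_weight k) ->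
    e \in edges V ->
  \sum_i l i * (g2m_of_pm (N i) e)%:R <= 4 / 3 * x e.
Proof.
move=> l1 lN ee; have mean k : \sum_i l i * (k \in N i)%:R = cubic_weight k.
  by rewrite -lN [RHS]big_mkcond; apply: eq_bigr => i _; rewrite mulr_natr mulrb.
have [es|es] := boolP (e \in supp x); last first.
  by rewrite supp_eq0 // mulr0 big1 // => i _; rewrite g2m_out // mulr0.
have /orP[eh|ef] := supp_half_or_full es.
  have xe : x e = 1 / 2 by move: eh; rewrite in_set => /andP[_ /eqP].
  rewrite (eq_bigr (fun i => l i - l i * (inl e \in N i)%:R)); last first.
    by move=> i _; rewrite g2m_half //; case: (_ \in N i); rewrite /= ?mulr1 ?mulr0; ring.
  rewrite sumrB l1 (mean (inl e)) /cubic_weight /= eh xe; lra.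
have xe : x e = 1 by move: ef; rewrite in_set => /andP[_ /eqP].
have [v ve] : exists v, v \in e.
  by apply/card_gt0P; move: ee; rewrite inE => /eqP->.
have efv : e \in full_at v by rewrite in_set ef.
rewrite (eq_bigr (fun i => l i + l i * (doubled (N i) v)%:R)); last first.
  by move=> i _; rewrite (g2m_full _ efv) -natr1; ring.
rewrite big_split /= l1 xe; have [Pv|nv] := eqVneq (P v) [::].
  by rewrite big1 /doubled ?Pv ?eqxx => [|i _]; rewrite ?mulr0 //; lra.
rewrite (eq_bigr (fun i => l i * (inr (path_end v) \in N i)%:R)); last first.
  by move=> i _; rewrite /doubled nv.
by rewrite (mean (inr (path_end v))) /cubic_weight /= path_end_ends //; lra.
Qed.

End Contraction.

End SupportStructure.

(** * Averaging and conclusion *)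

(** Otherwise the weighted deviations from the mean, whose sum is 0, would be positive wherever [l]
    is nonzero. The condition [l i != 0] is what makes [N i] a perfect matching. *)
Lemma exists_le_mean (R : realFieldType) (I : finType) (l F : I -> R) :
    (forall i, 0 <= l i) -> \sum_i l i = 1 ->
  exists2 i, l i != 0 & F i <= \sum_j l j * F j.
Proof.
move=> l0 l1; set M := \sum_j _.
case: (pickP (fun i => (l i != 0) && (F i <= M))) => [i /andP[]|no]; first by exists i.
have sum0 : \sum_i l i * (F i - M) = 0.
  rewrite (eq_bigr (fun i => l i * F i - l i * M)); last by move=> i _; rewrite mulrBr.
  by rewrite sumrB -mulr_suml l1 mul1r subrr.
have ge0 i : l i != 0 -> 0 < F i - M.
  by move=> li; have := no i; rewrite li /= => /negbT; rewrite -ltNge subr_gt0.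
have /eqP := sum0; rewrite psumr_eq0 => [/allP h|i _]; last first.
  by have [->|/ge0/ltW] := eqVneq (l i) 0; rewrite ?mul0r // => ?; apply: mulr_ge0.
have : \sum_i l i = 0.
  apply: big1 => i _; apply/eqP; apply: contraT => li.
  by have := h i (mem_index_enum _); rewrite /= mulf_eq0 (negbTE li) gt_eqF ?ge0.
by rewrite l1 => /eqP; rewrite oner_eq0.
Qed.

Theorem theorem3 (R : realFieldType) (V : finType) (c x : {set V} -> R)
    (hV : (3 <= #|V|)%N)
    (hc : {in edges V, forall e, 0 <= c e})
    (hx : is_F2M c x)
    (hcut : forall e : {set V}, ~ cut_edge x e) :
  exists m : {set V} -> nat,
    is_G2M m /\ cost c (fun e => (m e)%:R) <= 4 / 3 * cost c x.
Proof.
have [[xfeas _] xstruct] := hx; have [P PP] := path_system_exists xfeas xstruct.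
have /card_gt0P[v0 _] : (0 < #|V|)%N by apply: leq_trans hV.
have xP := cubic_fractional_pm xfeas xstruct v0 PP hcut.
have [I [l [N [l0 l1 lN Npm]]]] := fractional_pm_convex xP.
have [i li le] := exists_le_mean (fun i => cost c (fun e => (g2m_of_pm x P v0 (N i) e)%:R)) l0 l1.
exists (g2m_of_pm x P v0 (N i)); split.
  apply: (g2m_of_pmP xfeas xstruct PP); last exact: Npm.
  (* An edge in a matching of nonzero weight has nonzero marginal, so it is an edge of the cubic
     multigraph. *)
  move=> k kN; have := marginal_neq0 (P := fun i => k \in N i) l0 li kN.
  by rewrite lN /cubic_weight; case: ifP => //; rewrite eqxx.
apply: le_trans le _; rewrite /cost mulr_sumr.
under eq_bigr do rewrite mulr_sumr.
rewrite exchange_big /=; apply: ler_sum => e ee.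
rewrite (eq_bigr (fun j => c e * (l j * (g2m_of_pm x P v0 (N j) e)%:R))); last by move=> j _; ring.
rewrite -mulr_sumr mulrCA ler_wpM2l ?hc //.
exact: (mean_g2m_le xfeas xstruct PP).
Qed.
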